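(* Let $J$ be a real analytic almost complex structure in a neighborhood of the origin of $\mathbb{R}^{2n}$. There is $r>0$ such that the following holds. Let $(x_k)_{k\in\mathbb{N}}$ be a sequence of vectors of $\mathbb{R}^{2n}$ such that $|x_0|<r$ (that is, $x_0$ is close enough to the origin) and such that there exists $R>0$ with $|x_k|\le k!\,R^k$ for all integers $k\ge1$. Then there exists a germ of $J$-holomorphic disc $\gamma$ such that $\frac{\partial^k\gamma}{\partial x^k}(0)=x_k$ for all $k\in\mathbb{N}$ (with $\gamma(0)=x_0$ for $k=0$).
   Context: An almost complex structure is a field $J$ of endomorphisms of the tangent spaces with $J^2=-\mathrm{Id}$; as a normalization, $J(0)=J_0$, the standard complex structure of $\mathbb{R}^{2n}=\mathbb{C}^n$ (and, without restriction, $J$ is as close to $J_0$ as needed). A germ of $J$-holomorphic disc is a $C^1$ map $\gamma$ defined on some disc $\{|\zeta|<\varepsilon\}\subset\mathbb{C}$, $\varepsilon>0$, $\zeta=x+iy$, with values in $\mathbb{R}^{2n}$ and with $d\gamma(\zeta)\circ J_0=J(\gamma(\zeta))\circ d\gamma(\zeta)$ ($J_0$ the standard structure of $\mathbb{C}$). $\mathbb{N}$ contains $0$. *)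

(* Defs.v *)
From HB Require Import structures.
From mathcomp Require Import all_boot all_order all_algebra.
From mathcomp Require Import all_classical all_reals all_analysis.

Set Implicit Arguments.
Unset Strict Implicit.
Unset Printing Implicit Defensive.

Import Order.TTheory GRing.Theory Num.Theory.
Import numFieldNormedType.Exports.

Local Open Scope classical_set_scope.
Local Open Scope ring_scope.

(* The library norm `|x| on column vectors is the sup norm, hence this. *)
Definition enorm (R : realType) (m : nat) (x : 'cV[R]_m) : R :=
  Num.sqrt (\sum_(i < m) x i 0 ^+ 2).

Definition monom (R : realType) (m : nat) (x : 'cV[R]_m)
    (a : {ffun 'I_m -> nat}) : R :=
  \prod_(i < m) x i 0 ^+ a i.

(* Partial sum over the multi-indices all of whose entries are < N. *)
Definition box_sum (R : realType) (m : nat) (F : {ffun 'I_m -> nat} -> R)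
    (N : nat) : R :=
  \sum_(a : {ffun 'I_m -> 'I_N}) F [ffun i => nat_of_ord (a i)].

(* Near p, f is the sum of an absolutely convergent power series in x - p;
   given summability, the order of summation (here, by boxes) is irrelevant. *)
Definition real_analytic_at (R : realType) (m : nat) (f : 'cV[R]_m -> R)
    (p : 'cV[R]_m) : Prop :=
  exists c : {ffun 'I_m -> nat} -> R, \forall x \near p,
    summable [set: {ffun 'I_m -> nat}]
      (fun a => (c a * monom (x - p) a)%:E) /\
    box_sum (fun a => c a * monom (x - p) a) @ \oo --> f x.

Definition real_analytic_mx_on (R : realType) (m k l : nat)
    (U : set 'cV[R]_m) (A : 'cV[R]_m -> 'M[R]_(k, l)) : Prop :=
  forall p, U p -> forall i j, real_analytic_at (fun q => A q i j) p.

(* J_0 on R^{2n} = C^n, with coordinates (x_1, .., x_n, y_1, .., y_n):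
   J_0 (x, y) = (- y, x), acting on column vectors from the left.
   C itself is R^{1+1}, with the structure Jstd R 1. *)
Definition Jstd (R : realType) (n : nat) : 'M[R]_(n + n) :=
  block_mx 0 (- 1%:M) 1%:M 0.

Definition almost_complex_on (R : realType) (n : nat)
    (U : set 'cV[R]_(n + n)) (J : 'cV[R]_(n + n) -> 'M[R]_(n + n)) : Prop :=
  forall p, U p -> J p *m J p = - 1%:M.

Definition disc (R : realType) (eps : R) : set 'cV[R]_(1 + 1) :=
  [set z | enorm z < eps].

Definition C1_on (R : realType) (m k : nat) (D : set 'cV[R]_m)
    (f : 'cV[R]_m -> 'cV[R]_k) : Prop :=
  (forall z, D z -> differentiable f z) /\
  (forall v z, D z -> {for z, continuous (fun w => 'd f w v)}).

(* Only the germ of gamma at 0 matters: values off the disc are junk.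
   J is only meaningful on U, so gamma must map the disc into U. *)
Definition Jholomorphic_disc_germ (R : realType) (n : nat)
    (U : set 'cV[R]_(n + n)) (J : 'cV[R]_(n + n) -> 'M[R]_(n + n))
    (gamma : 'cV[R]_(1 + 1) -> 'cV[R]_(n + n)) : Prop :=
  exists2 eps : R, 0 < eps &
    [/\ forall z, disc eps z -> U (gamma z),
        C1_on (disc eps) gamma &
        forall z, disc eps z -> forall v : 'cV[R]_(1 + 1),
          'd gamma z (Jstd R 1 *m v) = J (gamma z) *m 'd gamma z v].

Definition e_x (R : realType) : 'cV[R]_(1 + 1) := delta_mx 0 0.

Definition xderiv (R : realType) (m k : nat)
    (f : 'cV[R]_(1 + 1) -> 'cV[R]_m) : 'cV[R]_(1 + 1) -> 'cV[R]_m :=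
  iter k (fun g z => 'D_(e_x R) g z) f.

(* d^k f / dx^k exists near z and takes the value v at z; existence has to be
   required separately because 'D is total, with junk values. *)
Definition is_xderiv (R : realType) (m k : nat)
    (f : 'cV[R]_(1 + 1) -> 'cV[R]_m) (z : 'cV[R]_(1 + 1)) (v : 'cV[R]_m) :
    Prop :=
  (forall j, (j < k)%N ->
     \forall w \near z, derivable (xderiv j f) w (e_x R)) /\
  xderiv k f z = v.

(* Main.v *)
(* A J-holomorphic disc is a solution of the quasilinear Cauchy problem
   gamma_y = J(gamma) gamma_x, gamma(x, 0) = sum_k x_k x^k / k!, the other half
   of the equation following from J^2 = -1; so this is a Cauchy-Kovalevskaya
   theorem, with radius for x_0 given only by the domain of J.

   Write gamma = x_0 + u. On power series in (x, y), the l^1 norm in which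
   x^j y^k weighs s^(j+k) / (C(j+k, k) lam^k) is submultiplicative, and
   (f, g) |-> int_0^y f g_x is bounded by 1/lam in it: the binomial
   coefficients absorb the lost derivative. Hence for lam large a ball is stable
   under the Picard iteration. Giving y the weight 2 and x the weight 1,
   the iterates, which are polynomials, also stabilise coefficientwise, so they
   converge, geometrically, on a smaller disc. A second order Taylor estimate,
   uniform over the ball, passes to the limit and gives differentiability of the
   limit and the identification of its derivatives. *)

From HB Require Import structures.
Require Import Defs.
From mathcomp Require Import all_boot all_order all_algebra.
From mathcomp Require Import all_classical all_reals all_analysis.
From mathcomp Require Import ring lra zify.
Import Order.TTheory GRing.Theory Num.Theory.
Import numFieldNormedType.Exports.
Local Open Scope classical_set_scope.
Local Open Scope ring_scope.

Set Implicit Arguments.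
Unset Strict Implicit.
Unset Printing Implicit Defensive.

(** * Polynomials in x and y: derivations, integration in y, evaluation *)

Section BivariatePolynomials.
Variable R : realFieldType.
Local Notation P := {poly {poly R}}.

(* The outer variable of {poly {poly R}} is y, the inner one x. *)
Definition mono (c : R) (k j : nat) : P := (c *: 'X^j) *: 'X^k.

Lemma coef_mono c k j a b : (mono c k j)`_a`_b = c * ((b == j) && (a == k))%:R.
Proof.
rewrite /mono coefZ coefXn mulr_natr.
case: (a == k); rewrite ?andbF ?andbT /= ?mulr1n ?mulr0n ?coef0 ?mulr0 //.
by rewrite coefZ coefXn.
Qed.

Lemma eq_coef2 (f g : P) : (forall k j, f`_k`_j = g`_k`_j) -> f = g.
Proof. by move=> fg; apply/polyP => k; apply/polyP => j. Qed.

Lemma monoM c k j c' k' j' :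
  mono c k j * mono c' k' j' = mono (c * c') (k + k') (j + j').
Proof.
by rewrite /mono -!mul_polyC !polyCM !exprD; ring.
Qed.

Definition dX (f : P) : P := map_poly (fun p : {poly R} => p^`()) f.

Lemma coef_dX f k j : (dX f)`_k`_j = f`_k`_j.+1 *+ j.+1.
Proof. by rewrite coef_map_id0 ?coef_deriv // deriv0. Qed.

Lemma coef_dY (f : P) k j : (f^`())`_k`_j = f`_k.+1`_j *+ k.+1.
Proof. by rewrite coef_deriv coefMn. Qed.

(** The primitive in y vanishing on y = 0: at [k = 0] the convention 0^-1 = 0 kills the coefficient,
    although [k.-1] is then 0 as well. *)
Definition intY (f : P) : P :=
  \poly_(k < (size f).+1) (k%:R^-1 *: f`_k.-1).

Lemma coef_intY f k j : (intY f)`_k`_j = k%:R^-1 * f`_k.-1`_j.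
Proof.
rewrite coef_poly ltnS; case: ifPn => [_|]; first by rewrite coefZ.
case: k => [|k] //; rewrite -ltnNge ltnS => sk.
by rewrite [f`__]nth_default // coef0 mulr0.
Qed.

Lemma intYK f : (intY f)^`() = f.
Proof.
apply: eq_coef2 => k j; rewrite coef_dY coef_intY /= -[LHS]mulr_natl mulrA.
by rewrite divff ?mul1r ?pnatr_eq0.
Qed.

Lemma dXD f g : dX (f + g) = dX f + dX g.
Proof. by apply: eq_coef2 => k j; rewrite !(coefD, coef_dX) mulrnDl. Qed.

Lemma dXB f g : dX (f - g) = dX f - dX g.
Proof. by apply: eq_coef2 => k j; rewrite !(coefD, coefN, coef_dX) mulrnDl mulNrn. Qed.

Lemma intYD f g : intY (f + g) = intY f + intY g.
Proof. by apply: eq_coef2 => k j; rewrite !(coefD, coef_intY) mulrDr. Qed.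

Lemma intYB f g : intY (f - g) = intY f - intY g.
Proof. by apply: eq_coef2 => k j; rewrite !(coefD, coefN, coef_intY) mulrBr. Qed.

Lemma intY_sum I (r : seq I) (Q : pred I) (F : I -> P) :
  intY (\sum_(i <- r | Q i) F i) = \sum_(i <- r | Q i) intY (F i).
Proof.
apply: (big_morph _ intYD); apply: eq_coef2 => k j.
by rewrite coef_intY !coef0 mulr0.
Qed.

Lemma dX_mono c k j : dX (mono c k j) = mono (c * j%:R) k j.-1.
Proof.
apply: eq_coef2 => a b; rewrite coef_dX !coef_mono.
case: j => [|j]; first by rewrite /= !mulr0n !mulr0 mul0r mul0rn.
rewrite eqSS -[LHS]mulr_natr -!mulrA.
by case: eqP => [->|]; rewrite /= ?mul0r ?mulr0 // (mulrC j.+1%:R).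
Qed.

Lemma dY_mono c k j : (mono c k j)^`() = mono (c * k%:R) k.-1 j.
Proof.
apply: eq_coef2 => a b; rewrite coef_dY !coef_mono.
case: k => [|k]; first by rewrite /= andbF !mulr0n !mulr0 mul0r mul0rn.
rewrite eqSS -[LHS]mulr_natr -!mulrA.
by case: (a =P k) => [->|]; rewrite /= ?andbF ?mul0r ?mulr0 // (mulrC k.+1%:R).
Qed.

Lemma intY_mono c k j : intY (mono c k j) = mono (c / k.+1%:R) k.+1 j.
Proof.
apply: eq_coef2 => a b; rewrite coef_intY !coef_mono.
case: a => [|a]; first by rewrite invr0 mul0r andbF mulr0.
by rewrite eqSS; case: (a =P k) => [->|] /=; rewrite ?andbF ?andbT ?mulr0 //; ring.
Qed.

Definition ev (x y : R) : P -> R := horner_eval x \o horner_eval y%:P.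
HB.instance Definition _ x y := GRing.RMorphism.on (ev x y).

Lemma ev_mono x y c k j : ev x y (mono c k j) = c * x ^+ j * y ^+ k.
Proof. by rewrite /ev /mono /= /horner_eval !hornerE. Qed.

Lemma evC x y c : ev x y c%:P%:P = c.
Proof. by rewrite /ev /= /horner_eval !hornerE. Qed.

Lemma evB x y f g : ev x y (f - g) = ev x y f - ev x y g.
Proof. exact: rmorphB. Qed.

Lemma ev00 f : ev 0 0 f = f`_0`_0.
Proof. by rewrite /ev /= /horner_eval polyC0 !horner_coef0. Qed.

(** * Weighted order of vanishing at the origin *)

(* Vanishing to order N at the origin when y has weight 2 and x weight 1. With
   these weights [intY (f * dX g)] gains one order, so that Picard iterates
   stabilise; for the total degree it would gain nothing. *)
Definition ord_ge (N : nat) (f : P) := forall k j, (k + k + j < N)%N -> f`_k`_j = 0.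

Lemma ord_ge0 N : ord_ge N 0.
Proof. by move=> k j _; rewrite !coef0. Qed.

Lemma ord_geD N f g : ord_ge N f -> ord_ge N g -> ord_ge N (f + g).
Proof. by move=> fN gN k j kj; rewrite !coefD fN ?gN ?addr0. Qed.

Lemma ord_geN N f : ord_ge N f -> ord_ge N (- f).
Proof. by move=> fN k j kj; rewrite !coefN fN ?oppr0. Qed.

Lemma ord_ge_sum N I (r : seq I) (Q : pred I) (F : I -> P) :
  (forall i, Q i -> ord_ge N (F i)) -> ord_ge N (\sum_(i <- r | Q i) F i).
Proof. by move=> FN; elim/big_ind: _ => //; [exact: ord_ge0 | exact: ord_geD]. Qed.

Lemma ord_geW M N f : (M <= N)%N -> ord_ge N f -> ord_ge M f.
Proof. by move=> MN fN k j kj; apply/fN/leq_trans/MN. Qed.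

Lemma ord_ge_all0 f : ord_ge 0 f. Proof. by []. Qed.

Lemma ord_geM M N f g : ord_ge M f -> ord_ge N g -> ord_ge (M + N) (f * g).
Proof.
move=> fM gN k j kj; rewrite coefM coef_sum big1 // => -[i /= ik] _.
rewrite coefM big1 // => -[l /= lj] _.
(* The weighted degrees of the two coefficients add up to less than M + N, so one of them lies below
   the order of its factor. *)
have [il|il] := ltnP (i + i + l) M; first by rewrite fM ?mul0r.
by rewrite gN ?mulr0 //; lia.
Qed.

Lemma ord_geMl N f g : ord_ge N f -> ord_ge N (f * g).
Proof. by move=> fN; rewrite -(addn0 N); apply: ord_geM. Qed.

Lemma ord_geMr N f g : ord_ge N g -> ord_ge N (f * g).
Proof. by move=> gN; rewrite mulrC; apply: ord_geMl. Qed.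

Lemma ord_geX a f : ord_ge 1 f -> ord_ge a (f ^+ a).
Proof.
by move=> f1; elim: a => // a IH; rewrite exprS -[a.+1]add1n; apply: ord_geM.
Qed.

Lemma ord_ge_dX N f : ord_ge N.+1 f -> ord_ge N (dX f).
Proof. by move=> fN k j kj; rewrite coef_dX fN ?mul0rn // addnS. Qed.

Lemma ord_ge_dY N f : ord_ge N.+2 f -> ord_ge N f^`().
Proof. by move=> fN k j kj; rewrite coef_dY fN ?mul0rn //; lia. Qed.

Lemma ord_ge_intY N f : ord_ge N f -> ord_ge N.+2 (intY f).
Proof.
move=> fN k j kj; rewrite coef_intY; case: k kj => [|k] kj.
  by rewrite invr0 mul0r.
by rewrite fN ?mulr0 //=; lia.
Qed.

(** * Weighted l^1 norms *)

(* The weighted l^1 norm of f is at most C; stating it through an arbitrary,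
   possibly redundant, list of monomials makes products immediate. *)
Definition l1_le (w : nat -> nat -> R) (f : P) (C : R) :=
  exists s : seq (R * (nat * nat)), f = \sum_(t <- s) mono t.1 t.2.1 t.2.2 /\
  \sum_(t <- s) `|t.1| * w t.2.1 t.2.2 <= C.

Section Norm.
Variable w : nat -> nat -> R.
Hypothesis w_ge0 : forall k j, 0 <= w k j.

Lemma l1_le_ge0 f C : l1_le w f C -> 0 <= C.
Proof.
by move=> [s [_]]; apply: le_trans; apply: sumr_ge0 => t _; rewrite mulr_ge0.
Qed.

Lemma l1_leW f C D : C <= D -> l1_le w f C -> l1_le w f D.
Proof. by move=> CD [s [fs sC]]; exists s; split=> //; apply: le_trans CD. Qed.

Lemma l1_le_mono c k j : l1_le w (mono c k j) (`|c| * w k j).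
Proof. by exists [:: (c, (k, j))]; rewrite !big_seq1. Qed.

Lemma l1_le0 : l1_le w 0 0.
Proof. by exists [::]; rewrite !big_nil. Qed.

Lemma l1_leD f g C D : l1_le w f C -> l1_le w g D -> l1_le w (f + g) (C + D).
Proof.
move=> [s [-> sC]] [s' [-> sD]]; exists (s ++ s').
by rewrite !big_cat /=; split=> //; apply: lerD.
Qed.

Lemma l1_leN f C : l1_le w f C -> l1_le w (- f) C.
Proof.
move=> [s [-> sC]]; exists [seq (- t.1, t.2) | t <- s]; rewrite !big_map; split.
  rewrite -sumrN; apply: eq_bigr => t _.
  by apply: eq_coef2 => a b; rewrite !coefN !coef_mono mulNr.
by under eq_bigr do rewrite /= normrN.
Qed.

Lemma l1_leB f g C D : l1_le w f C -> l1_le w g D -> l1_le w (f - g) (C + D).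
Proof. by move=> fC gD; apply/l1_leD/l1_leN. Qed.

Lemma l1_le_sum I (r : seq I) (Q : pred I) (F : I -> P) (C : I -> R) :
  (forall i, Q i -> l1_le w (F i) (C i)) ->
  l1_le w (\sum_(i <- r | Q i) F i) (\sum_(i <- r | Q i) C i).
Proof.
by move=> FN; elim/big_ind2: _ => //; [exact: l1_le0 | move=> *; exact: l1_leD].
Qed.

(** For an l^1 norm the constant of a bilinear operation can be read off on pairs of monomials. *)
Lemma l1_le_bilin (op : P -> P -> P) (K : R) f g C D :
  0 <= K ->
  (forall a b c, op (a + b) c = op a c + op b c) ->
  (forall a b c, op a (b + c) = op a b + op a c) ->
  (forall c k j c' k' j', l1_le w (op (mono c k j) (mono c' k' j'))
     (K * (`|c| * w k j) * (`|c'| * w k' j'))) ->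
  l1_le w f C -> l1_le w g D -> l1_le w (op f g) (K * C * D).
Proof.
move=> K0 opDl opDr op_mono [s [-> sC]] [s' [-> sD]].
have op0l c : op 0 c = 0.
  by apply: (@addrI _ (op 0 c)); rewrite -opDl !addr0.
have op0r c : op c 0 = 0.
  by apply: (@addrI _ (op c 0)); rewrite -opDr !addr0.
rewrite (big_morph (op^~ _) (fun a b => opDl a b _) (op0l _)).
apply: (@l1_leW _ (\sum_(t <- s) \sum_(t' <- s')
   K * (`|t.1| * w t.2.1 t.2.2) * (`|t'.1| * w t'.2.1 t'.2.2))).
  under eq_bigr do rewrite -mulr_sumr.
  rewrite -mulr_suml -mulr_sumr; apply: ler_pM => //.
  - by rewrite mulr_ge0 // sumr_ge0 // => t _; rewrite mulr_ge0.
  - by rewrite sumr_ge0 // => t _; rewrite mulr_ge0.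
  - by rewrite ler_wpM2l.
apply: l1_le_sum => t _; rewrite (big_morph (op _) (opDr _) (op0r _)).
by apply: l1_le_sum => t' _.
Qed.

Lemma l1_le_lin (L : P -> R) (K : R) f C N :
  0 <= K ->
  (forall a b, L (a + b) = L a + L b) ->
  (forall c k j, (N <= k + k + j)%N -> `|L (mono c k j)| <= K * (`|c| * w k j)) ->
  ord_ge N f -> l1_le w f C -> `|L f| <= K * C.
Proof.
move=> K0 LD L_mono fN [s [fs sC]].
have L0 : L 0 = 0 by apply: (@addrI _ (L 0)); rewrite -LD !addr0.
(* The list may contain monomials of low order that cancel in the sum. Dropping them leaves f
   unchanged and does not increase the norm, so [L] meets only monomials of order at least [N]. *)
have {}fs : f = \sum_(t <- s | (N <= t.2.1 + t.2.1 + t.2.2)%N) mono t.1 t.2.1 t.2.2.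
  apply: eq_coef2 => k j; have [kjN|Nkj] := ltnP (k + k + j) N.
    rewrite fN // !coef_sum big1 // => t Nt; rewrite coef_mono.
    by case: andP => [[/eqP kt /eqP jt]|]; [lia|rewrite mulr0].
  rewrite {1}fs [in LHS](bigID (fun t => (N <= t.2.1 + t.2.1 + t.2.2)%N)) /= !coefD.
  rewrite [X in _ + X](_ : _ = 0) ?addr0 // !coef_sum big1 // => t.
  rewrite -ltnNge coef_mono => Nt.
  by case: andP => [[/eqP kt /eqP jt]|]; [lia|rewrite mulr0].
rewrite fs (big_morph _ LD L0); apply: le_trans (ler_norm_sum _ _ _) _.
apply: (@le_trans _ _ (\sum_(t <- s | (N <= t.2.1 + t.2.1 + t.2.2)%N)
   K * (`|t.1| * w t.2.1 t.2.2))).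
  by apply: ler_sum => t Nt; apply: L_mono.
rewrite -mulr_sumr ler_wpM2l //; apply: le_trans sC.
rewrite [leRHS](bigID (fun t => (N <= t.2.1 + t.2.1 + t.2.2)%N)) /= lerDl.
by apply: sumr_ge0 => t _; rewrite mulr_ge0.
Qed.

End Norm.

Lemma l1_le_map (w w' : nat -> nat -> R) (op : P -> P) (K : R) f C :
  0 <= K ->
  (forall a b, op (a + b) = op a + op b) ->
  (forall c k j, l1_le w' (op (mono c k j)) (K * (`|c| * w k j))) ->
  l1_le w f C -> l1_le w' (op f) (K * C).
Proof.
move=> K0 opD op_mono [s [-> sC]].
have op0 : op 0 = 0 by apply: (@addrI _ (op 0)); rewrite -opD !addr0.
rewrite (big_morph _ opD op0).
apply: (@l1_leW _ _ (\sum_(t <- s) K * (`|t.1| * w t.2.1 t.2.2))).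
  by rewrite -mulr_sumr ler_wpM2l.
exact: l1_le_sum.
Qed.

Lemma l1_le_weight (w w' : nat -> nat -> R) f C :
  (forall k j, w' k j <= w k j) -> l1_le w f C -> l1_le w' f C.
Proof.
move=> ww' fC; rewrite -(mul1r C); apply: (@l1_le_map w w' id) fC => // c k j.
by rewrite mul1r; apply: l1_leW (l1_le_mono _ _ _ _); rewrite ler_wpM2l.
Qed.

Section Submultiplicative.
Variable w : nat -> nat -> R.
Hypothesis w_ge0 : forall k j, 0 <= w k j.
Hypothesis w00 : w 0 0 = 1.
Hypothesis wM : forall k j k' j', w (k + k') (j + j') <= w k j * w k' j'.

Lemma l1_leC c : l1_le w c%:P%:P `|c|.
Proof.
rewrite -[X in l1_le w _ X]mulr1 -w00.
rewrite (_ : c%:P%:P = mono c 0 0); first exact: l1_le_mono.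
by rewrite /mono !expr0 !alg_polyC.
Qed.

Lemma l1_leM f g C D : l1_le w f C -> l1_le w g D -> l1_le w (f * g) (C * D).
Proof.
move=> fC gD; rewrite -[C]mul1r.
apply: (@l1_le_bilin w w_ge0 *%R) fC gD => //.
- exact: mulrDl.
- exact: mulrDr.
move=> c k j c' k' j'; rewrite monoM; apply: l1_leW (l1_le_mono _ _ _ _).
rewrite mul1r normrM mulrACA ler_wpM2l ?mulr_ge0 //; exact: wM.
Qed.

Lemma l1_leX f C a : l1_le w f C -> l1_le w (f ^+ a) (C ^+ a).
Proof.
move=> fC; elim: a => [|a IH]; last by rewrite !exprS; apply: l1_leM.
by have := l1_leC 1; rewrite normr1 !expr0 -!polyC1.
Qed.

Lemma l1_le_prod I (r : seq I) (Q : pred I) (F : I -> P) (C : I -> R) :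
  (forall i, Q i -> l1_le w (F i) (C i)) ->
  l1_le w (\prod_(i <- r | Q i) F i) (\prod_(i <- r | Q i) C i).
Proof.
move=> FC; elim/big_ind2: _ => //; last by move=> *; exact: l1_leM.
by have := l1_leC 1; rewrite normr1 -!polyC1.
Qed.

End Submultiplicative.

(** * The weight that absorbs one derivative in x *)

(* The binomial coefficient makes the derivative loss of [intY (f * dX g)]
   harmless, and each power of [y] gains a factor [lam^-1]. *)
Definition ck_weight (s lam : R) (k j : nat) : R :=
  s ^+ (k + j) / ('C(k + j, k)%:R * lam ^+ k).

Section CKWeight.
Variables (s lam : R).
Hypotheses (s_gt0 : 0 < s) (lam_ge1 : 1 <= lam).
Local Notation w := (ck_weight s lam).

Let lam_gt0 : 0 < lam. Proof. exact: lt_le_trans lam_ge1. Qed.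
Let lam_ge0 : 0 <= lam. Proof. exact: ltW. Qed.
Let s_ge0 : 0 <= s. Proof. exact: ltW. Qed.

Lemma ck_weight_gt0 k j : 0 < w k j.
Proof.
by rewrite divr_gt0 ?exprn_gt0 ?mulr_gt0 ?exprn_gt0 // ltr0n bin_gt0 leq_addr.
Qed.

Lemma ck_weight00 : w 0 0 = 1.
Proof. by rewrite /ck_weight bin0 !expr0 mul1r mulr1 invr1. Qed.

Lemma ck_weight0 j : w 0 j = s ^+ j.
Proof. by rewrite /ck_weight bin0 expr0 !mul1r invr1 mulr1. Qed.

(** The left side is one term of the Vandermonde convolution for the right side. *)
Lemma leq_binM m n k l : ('C(m, k) * 'C(n, l) <= 'C(m + n, k + l))%N.
Proof.
rewrite -binomial.Vandermonde; have kl : (k < (k + l).+1)%N by rewrite ltnS leq_addr.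
by rewrite (bigD1 (Ordinal kl)) //= addKn leq_addr.
Qed.

Lemma ck_weightM k j k' j' : w (k + k') (j + j') <= w k j * w k' j'.
Proof.
rewrite /ck_weight addnACA mulrACA -exprD -invfM ler_wpM2l ?exprn_ge0 //.
rewrite lef_pV2 ?posrE ?mulr_gt0 ?exprn_gt0 ?ltr0n ?bin_gt0 ?leq_addr //.
  by rewrite mulrACA -exprD ler_wpM2r ?exprn_ge0 // -natrM ler_nat leq_binM.
by rewrite addnACA leq_addr.
Qed.

(** The fraction is the coefficient of int_0^y of y^b x^a times the x-derivative of y^k x^j. With n
    the total degree, (b+k+1) C(n, b+k+1) = (a+j) C(n, b+k): here a+j >= j pays for the derivative,
    and C(n, b+k) dominates the product of the binomials of the two factors. *)
Lemma ck_weight_step b a k j :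
  (0 < j)%N ->
  j%:R / (b + k).+1%:R * w (b + k).+1 (a + j).-1 <= lam^-1 * (w b a * w k j).
Proof.
case: j => // j _; rewrite addnS /=.
rewrite /ck_weight; set n := (b + a + (k + j.+1))%N.
have -> : ((b + k).+1 + (a + j) = n)%N by rewrite /n; lia.
rewrite [leRHS](_ : _ = s ^+ n * (lam ^+ (b + k).+1)^-1 *
   ('C(b + a, b)%:R * 'C(k + j.+1, k)%:R)^-1); last first.
  by rewrite /n (exprD s (b + a)) (exprS lam) (exprD lam) !invfM; ring.
rewrite [leLHS](_ : _ = s ^+ n * (lam ^+ (b + k).+1)^-1 *
   (j.+1%:R / (b + k).+1%:R / 'C(n, (b + k).+1)%:R)); last first.
  by rewrite !invfM; ring.
rewrite ler_wpM2l ?mulr_ge0 ?invr_ge0 ?exprn_ge0 //.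
have Cgt0 : (0 < 'C(b + a, b) * 'C(k + j.+1, k))%N.
  by rewrite muln_gt0 !bin_gt0 !leq_addr.
have C'gt0 : (0 < 'C(n, (b + k).+1))%N by rewrite bin_gt0 /n; lia.
rewrite -natrM ler_pdivrMr ?ltr0n // [leRHS]mulrC ler_pdivlMr ?ltr0n //.
rewrite mulrAC ler_pdivrMr ?ltr0n // -!natrM ler_nat.
rewrite [leqRHS]mulnC mul_bin_left; apply: leq_mul; first by rewrite /n; lia.
by have := leq_binM (b + a) (k + j.+1) b k.
Qed.

Lemma l1_le_intYMdX f g C D :
  l1_le w f C -> l1_le w g D -> l1_le w (intY (f * dX g)) (lam^-1 * C * D).
Proof.
have w_ge0 k j : 0 <= w k j by rewrite ltW ?ck_weight_gt0.
apply: (@l1_le_bilin w w_ge0 (fun f g => intY (f * dX g))) => //.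
- by rewrite invr_ge0 ltW.
- by move=> a b c; rewrite mulrDl intYD.
- by move=> a b c; rewrite dXD mulrDr intYD.
move=> c b a d k j; rewrite dX_mono monoM intY_mono.
apply: l1_leW (l1_le_mono _ _ _ _).
case: j => [|j].
  rewrite mulr0n !mulr0 mul0r normr0 mul0r.
  by apply: mulr_ge0; first apply: mulr_ge0; rewrite ?invr_ge0 ?(mulr_ge0 _ (w_ge0 _ _)).
rewrite -[(a + _)%N]/(a + j.+1.-1)%N !normrM normfV !normr_nat.
have := @ck_weight_step b a k j.+1 isT.
move=> /(ler_wpM2l (mulr_ge0 (normr_ge0 c) (normr_ge0 d))).
rewrite addnS /=; move: (w _ _) (w b a) (w k _) => x y z h.
rewrite [leLHS](_ : _ = `|c| * `|d| * (j.+1%:R / (b + k).+1%:R * x)); last by ring.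
by rewrite [leRHS](_ : _ = `|c| * `|d| * (lam^-1 * (y * z))); last by ring.
Qed.

(** Uses C(k+j, k) <= 2^(k+j) and lam^k <= lam^(k+j). It trades the special weight for a geometric
    one, which controls values near the origin. *)
Lemma ck_weight_ge k j : (s / (2 * lam)) ^+ (k + j) <= w k j.
Proof.
rewrite expr_div_n ler_wpM2l ?exprn_ge0 // lef_pV2 ?posrE; last first.
- by rewrite mulr_gt0 ?exprn_gt0 // ltr0n bin_gt0 leq_addr.
- by rewrite exprn_gt0 // mulr_gt0.
rewrite exprMn; apply: ler_pM; rewrite ?exprn_ge0 //.
  rewrite -natrX ler_nat.
  have -> : (2 ^ (k + j) = (1 + 1) ^ (k + j))%N by [].
  rewrite expnDn (bigD1 (inord k)) //= inordK ?ltnS ?leq_addr //.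
  by rewrite !exp1n !muln1 leq_addr.
by rewrite ler_weXn2l // leq_addr.
Qed.

End CKWeight.



(** * Geometric weights: derivatives and evaluation *)

Definition pow_weight (rho : R) (k j : nat) : R := rho ^+ (k + j).

Lemma pow_weight_ge0 rho k j : 0 <= rho -> 0 <= pow_weight rho k j.
Proof. exact: exprn_ge0. Qed.

Lemma natr_le_exp2 (i n : nat) : (i <= n)%N -> (i%:R : R) <= 2 ^+ n.
Proof.
by move=> ik; rewrite -natrX ler_nat (leq_trans ik) // ltnW // ltn_expl.
Qed.

(** A Cauchy estimate: halving the radius pays for the factor i of a derivative, since i <= n <=
    2^n. *)
Lemma pow_weight_half (rho : R) i n : 0 < rho -> (i <= n)%N ->
  i%:R * (rho / 2) ^+ n.-1 <= 2 / rho * rho ^+ n.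
Proof.
move=> rho0 ik; case: n ik => [|n] ik.
  by move: ik; rewrite leqn0 => /eqP ->; rewrite mul0r !mulr_ge0 ?invr_ge0 ?ltW.
rewrite /= [leRHS](_ : _ = 2 ^+ n.+1 * (rho / 2) ^+ n).
  by rewrite ler_wpM2r ?exprn_ge0 ?natr_le_exp2 // divr_ge0 // ltW.
rewrite expr_div_n !exprS; field.
by rewrite (gt_eqF rho0) expf_neq0 // pnatr_eq0.
Qed.

Lemma l1_le_dX rho f C : 0 < rho ->
  l1_le (pow_weight rho) f C -> l1_le (pow_weight (rho / 2)) (dX f) (2 / rho * C).
Proof.
move=> rho0; apply: (@l1_le_map (pow_weight rho) _ dX).
  - by rewrite divr_ge0 // ltW.
  - exact: dXD.
move=> c k j; rewrite dX_mono; apply: l1_leW (l1_le_mono _ _ _ _).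
rewrite normrM normr_nat mulrCA -mulrA ler_wpM2l // /pow_weight.
case: j => [|j]; first by rewrite mul0r !mulr_ge0 ?invr_ge0 ?exprn_ge0 ?ltW.
by rewrite addnS -[(k + _)%N]/((k + j).+1.-1) pow_weight_half // ltnS leq_addl.
Qed.

Lemma l1_le_dY rho f C : 0 < rho ->
  l1_le (pow_weight rho) f C -> l1_le (pow_weight (rho / 2)) f^`() (2 / rho * C).
Proof.
move=> rho0; apply: (@l1_le_map (pow_weight rho) _ (@deriv _)).
  - by rewrite divr_ge0 // ltW.
  - exact: derivD.
move=> c k j; rewrite dY_mono; apply: l1_leW (l1_le_mono _ _ _ _).
rewrite normrM normr_nat mulrCA -mulrA ler_wpM2l // /pow_weight.
case: k => [|k]; first by rewrite mul0r !mulr_ge0 ?invr_ge0 ?exprn_ge0 ?ltW.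
by rewrite addSn -[(_ + j)%N]/((k + j).+1.-1) pow_weight_half // ltnS leq_addr.
Qed.

(** As y counts twice, order N only forces 2 (k + j) >= N. On a quarter of the radius each variable
    gains 1/4 = 2^-2, so a monomial still gains 2^-N. *)
Lemma ev_le N rho f C x y : ord_ge N f -> l1_le (pow_weight rho) f C ->
  `|x| <= rho / 4 -> `|y| <= rho / 4 -> `|ev x y f| <= 2^-1 ^+ N * C.
Proof.
move=> fN fC xr yr; have rho0 : 0 <= rho by have := normr_ge0 x; lra.
apply: l1_le_lin fN fC => //.
- by move=> k j; apply: pow_weight_ge0.
- exact: rmorphD.
move=> c k j Nkj; rewrite ev_mono !normrM !normrX -mulrA [leRHS]mulrCA ler_wpM2l //.
apply: (@le_trans _ _ ((rho / 4) ^+ j * (rho / 4) ^+ k)).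
  by apply: ler_pM; rewrite ?exprn_ge0 // lerXn2r ?nnegrE // (le_trans _ xr).
rewrite -exprD addnC exprMn mulrC ler_wpM2r ?exprn_ge0 //.
have -> : 4^-1 = 2^-1 ^+ 2 :> R by field.
by rewrite -exprM; apply: ler_wiXn2l; [lra|lra|lia].
Qed.

(** * Second order Taylor estimates for polynomials *)

Section Taylor.
Variables (r h x x' : R).
Hypotheses (r0 : 0 < r) (xr : `|x| <= r) (x'r : `|x'| <= r) (xx' : `|x' - x| <= h).

Let h0 : 0 <= h. Proof. by apply: le_trans xx'. Qed.
Let r_ge0 : 0 <= r. Proof. exact: ltW. Qed.
Let r_le2 : r <= 2 * r. Proof. by rewrite mulr_natl mulr2n lerDl. Qed.
Let r2_le4 : 2 * r <= 4 * r. Proof. by rewrite ler_wpM2r // ler_nat. Qed.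

Lemma pow_deriv_le j : r * `|j%:R * x ^+ j.-1| <= (2 * r) ^+ j.
Proof.
case: j => [|j]; first by rewrite mul0r normr0 mulr0 expr0.
rewrite normrM normr_nat normrX /= mulrCA exprMn.
apply: ler_pM; rewrite ?natr_le_exp2 ?mulr_ge0 ?exprn_ge0 //.
by rewrite exprS ler_wpM2l // lerXn2r ?nnegrE.
Qed.

Lemma pow_lipschitz j : r * `|x' ^+ j - x ^+ j| <= (2 * r) ^+ j * h.
Proof.
elim: j => [|j IH]; first by rewrite subrr normr0 mulr0 expr0 mul1r.
have -> : x' ^+ j.+1 - x ^+ j.+1 = x' * (x' ^+ j - x ^+ j) + (x' - x) * x ^+ j.
  by rewrite !exprS; ring.
apply: le_trans (ler_wpM2l r_ge0 (ler_normD _ _)) _.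
rewrite mulrDr !normrM normrX.
have : r * (`|x'| * `|x' ^+ j - x ^+ j|) <= r * ((2 * r) ^+ j * h).
  by rewrite mulrCA ler_pM // mulr_ge0.
have : r * (`|x' - x| * `|x| ^+ j) <= r * (h * (2 * r) ^+ j).
  rewrite ler_wpM2l // ler_pM ?exprn_ge0 // (@le_trans _ _ (r ^+ j)) //.
    by rewrite lerXn2r ?nnegrE.
  by rewrite lerXn2r ?nnegrE ?mulr_ge0.
by rewrite exprS; lra.
Qed.

Lemma pow_taylor j :
  r ^+ 2 * `|x' ^+ j - x ^+ j - (x' - x) * (j%:R * x ^+ j.-1)| <= (4 * r) ^+ j * h ^+ 2.
Proof.
elim: j => [|j IH].
  by rewrite mul0r mulr0 subrr subr0 normr0 mulr0 expr0 mul1r exprn_ge0.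
(* The remainders satisfy T_(j+1) = x' T_j + (x' - x)^2 j x^(j-1). Each summand is at most r times
   the bound for j, and 2 r <= 4 r. *)
have -> : x' ^+ j.+1 - x ^+ j.+1 - (x' - x) * (j.+1%:R * x ^+ j.+1.-1) =
   x' * (x' ^+ j - x ^+ j - (x' - x) * (j%:R * x ^+ j.-1)) +
   (x' - x) * ((x' - x) * (j%:R * x ^+ j.-1)).
  by case: j {IH} => [|j] /=; rewrite ?mulr0n ?mulr1n ?expr0 ?expr1 ?exprS; ring.
apply: le_trans (ler_wpM2l (exprn_ge0 _ r_ge0) (ler_normD _ _)) _.
rewrite mulrDr ![`|_ * (_ - _)|]normrM ![`|(_ - _) * _|]normrM.
set A := `| _ - _ |; set B := `|_ * _|.
have [A0 B0] : 0 <= A /\ 0 <= B by rewrite !normr_ge0.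
have h1 : r ^+ 2 * (`|x'| * A) <= r * ((4 * r) ^+ j * h ^+ 2).
  by rewrite mulrCA ler_pM // mulr_ge0 ?exprn_ge0.
have h2 : r ^+ 2 * (`|x' - x| * (`|x' - x| * B)) <= r * ((4 * r) ^+ j * h ^+ 2).
  rewrite [leLHS](_ : _ = r * (r * B * (`|x' - x| * `|x' - x|))); last by ring.
  rewrite ler_wpM2l // ler_pM ?mulr_ge0 ?expr2 ?ler_pM //.
  apply: le_trans (pow_deriv_le _) _.
  by rewrite lerXn2r ?nnegrE ?mulr_ge0.
have h3 : 0 <= r * ((4 * r) ^+ j * h ^+ 2) by rewrite !mulr_ge0 ?exprn_ge0 ?mulr_ge0.
by rewrite [(4 * r) ^+ j.+1]exprS; lra.
Qed.

End Taylor.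

Lemma ev_taylor r h f C x y x' y' : 0 < r ->
  l1_le (pow_weight (4 * r)) f C ->
  `|x| <= r -> `|y| <= r -> `|x'| <= r -> `|y'| <= r ->
  `|x' - x| <= h -> `|y' - y| <= h ->
  `|ev x' y' f - ev x y f - (x' - x) * ev x y (dX f) - (y' - y) * ev x y f^`()|
    <= 3 / r ^+ 2 * h ^+ 2 * C.
Proof.
move=> r0 fC xr yr x'r y'r xh yh.
have h0 : 0 <= h by apply: le_trans xh.
have rge0 := ltW r0.
apply: (@l1_le_lin (pow_weight (4 * r)) _
  (fun f => ev x' y' f - ev x y f - (x' - x) * ev x y (dX f)
   - (y' - y) * ev x y f^`())) (@ord_ge_all0 f) fC.
- by move=> k j; apply: pow_weight_ge0; rewrite mulr_ge0.
- by rewrite !mulr_ge0 ?invr_ge0 ?exprn_ge0.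
- by move=> a b; rewrite dXD derivD !rmorphD /=; ring.
move=> c k j _; rewrite dX_mono dY_mono !ev_mono.
(* The remainder of x^j y^k splits into the remainder in x times y'^k, x^j times the remainder in y,
   and the first order term in x times the increment in y. Each is at most (4 r)^(k+j) h^2 / r^2,
   hence the 3. *)
have -> : c * x' ^+ j * y' ^+ k - c * x ^+ j * y ^+ k
    - (x' - x) * (c * j%:R * x ^+ j.-1 * y ^+ k)
    - (y' - y) * (c * k%:R * x ^+ j * y ^+ k.-1) =
  c * ((x' ^+ j - x ^+ j - (x' - x) * (j%:R * x ^+ j.-1)) * y' ^+ k +
       x ^+ j * (y' ^+ k - y ^+ k - (y' - y) * (k%:R * y ^+ k.-1)) +
       (x' - x) * (j%:R * x ^+ j.-1) * (y' ^+ k - y ^+ k)) by ring.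
rewrite normrM [leRHS]mulrCA ler_wpM2l // /pow_weight.
rewrite [leRHS](_ : _ = 3 * ((4 * r) ^+ (k + j) * h ^+ 2) / r ^+ 2); last by ring.
rewrite ler_pdivlMr ?exprn_gt0 // mulrC.
apply: le_trans (ler_wpM2l (exprn_ge0 _ rge0) (ler_normD _ _)) _.
apply: le_trans (ler_wpM2l (exprn_ge0 _ rge0) (lerD (ler_normD _ _) (lexx _))) _.
set F := (4 * r) ^+ (k + j) * h ^+ 2.
have r_le4 a (u : R) : 0 <= u -> u <= 4 * r -> u ^+ a <= (4 * r) ^+ a.
  by move=> u0 u4; rewrite lerXn2r ?nnegrE ?(le_trans u0).
have [r4 r24] : r <= 4 * r /\ 2 * r <= 4 * r.
  by rewrite ler_wpM2r ?ler_nat // -{1}(mul1r r) ler_wpM2r ?ler1n.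
have t1 : r ^+ 2 * `|(x' ^+ j - x ^+ j - (x' - x) * (j%:R * x ^+ j.-1)) * y' ^+ k| <= F.
  rewrite normrM [leLHS]mulrA /F addnC exprD [leRHS]mulrAC.
  apply: ler_pM; rewrite ?normr_ge0 ?pow_taylor //.
    by apply: mulr_ge0; rewrite ?exprn_ge0.
  by rewrite normrX; apply: r_le4; rewrite ?(le_trans y'r).
have t2 : r ^+ 2 * `|x ^+ j * (y' ^+ k - y ^+ k - (y' - y) * (k%:R * y ^+ k.-1))| <= F.
  rewrite normrM [leLHS]mulrCA /F addnC exprD -[leRHS]mulrA.
  apply: ler_pM; rewrite ?normr_ge0 ?pow_taylor //.
    by apply: mulr_ge0; rewrite ?exprn_ge0.
  by rewrite normrX; apply: r_le4; rewrite ?(le_trans xr).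
have t3 : r ^+ 2 * `|(x' - x) * (j%:R * x ^+ j.-1) * (y' ^+ k - y ^+ k)| <= F.
  rewrite 2!normrM [leLHS](_ : _ = `|x' - x| * ((r * `|j%:R * x ^+ j.-1|) *
    (r * `|y' ^+ k - y ^+ k|))); last by ring.
  rewrite /F addnC exprD [leRHS](_ : _ = h * ((4 * r) ^+ j * ((4 * r) ^+ k * h)));
    last by ring.
  rewrite ler_pM ?mulr_ge0 // ler_pM ?mulr_ge0 //.
    by apply: le_trans (pow_deriv_le r0 xr j) _; apply: r_le4; rewrite ?mulr_ge0.
  apply: le_trans (pow_lipschitz r0 yr y'r yh k) _; rewrite ler_wpM2r //.
  by apply: r_le4; rewrite ?mulr_ge0.
rewrite [leLHS]mulrDr [X in X + _ <= _]mulrDr; apply: le_trans (lerD (lerD t1 t2) t3) _.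
by rewrite mulr_natl !mulrS mulr0n addr0 addrA.
Qed.

(** * Box sums and substitution into a power series *)

(* [box_sum] with values in an arbitrary nmodType. *)
Definition boxs m (V : nmodType) (F : {ffun 'I_m -> nat} -> V) (N : nat) : V :=
  \sum_(a : {ffun 'I_m -> 'I_N}) F [ffun i => nat_of_ord (a i)].

(** Puts two box sums over one index type, so that they can be subtracted. *)
Lemma boxs_widen m (V : nmodType) (F : {ffun 'I_m -> nat} -> V) N K : (N <= K)%N ->
  boxs F N = \sum_(a : {ffun 'I_m -> 'I_K} | [forall i, a i < N]%N)
    F [ffun i => nat_of_ord (a i)].
Proof.
move=> NK; pose wd (a : {ffun 'I_m -> 'I_N}) := [ffun i => widen_ord NK (a i)].
have wd_inj : injective wd.
  move=> a b /ffunP ab; apply/ffunP => i; apply/val_inj.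
  by have := ab i; rewrite !ffunE => /(congr1 val).
rewrite (eq_bigl (mem (wd @: predT))) => [|b].
  rewrite big_imset => [|a b _ _]; last exact: wd_inj.
  by apply: eq_bigr => a _; congr F; apply/ffunP => i; rewrite !ffunE.
apply/forallP/imsetP => [bN|[a _ ->] i]; last by rewrite ffunE /=.
exists [ffun i => Ordinal (bN i)] => //.
by apply/ffunP => i; apply/val_inj; rewrite !ffunE.
Qed.

Lemma boxs_diff m (V : zmodType) (F : {ffun 'I_m -> nat} -> V) N K : (N <= K)%N ->
  boxs F K - boxs F N =
  \sum_(a : {ffun 'I_m -> 'I_K} | ~~ [forall i, a i < N]%N)
    F [ffun i => nat_of_ord (a i)].
Proof.
move=> NK; rewrite (boxs_widen _ NK) {1}/boxs.
rewrite (bigID (fun a : {ffun 'I_m -> 'I_K} => [forall i, a i < N]%N)) /=.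
by rewrite addrC addKr.
Qed.

Section Substitution.
Variables (m : nat) (c : {ffun 'I_m -> nat} -> R).

Definition subst_box (U : 'I_m -> P) (N : nat) : P :=
  boxs (fun a => (c a)%:P%:P * \prod_i U i ^+ a i) N.

Lemma ev_subst_box x y U N :
  ev x y (subst_box U N) = boxs (fun a => c a * \prod_i ev x y (U i) ^+ a i) N.
Proof.
rewrite /subst_box /boxs rmorph_sum; apply: eq_bigr => a _.
rewrite rmorphM rmorph_prod /= evC; congr (_ * _).
by apply: eq_bigr => i _; rewrite rmorphXn.
Qed.

Lemma ord_ge_prod_diff N (U U' : 'I_m -> P) (a : {ffun 'I_m -> nat}) :
  (forall i, ord_ge N (U' i - U i)) ->
  ord_ge N (\prod_i U' i ^+ a i - \prod_i U i ^+ a i).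
Proof.
move=> UU'.
have stepM (f f' g g' : P) :
    ord_ge N (f' - f) -> ord_ge N (g' - g) -> ord_ge N (f' * g' - f * g).
  move=> ff' gg'; rewrite (_ : _ - _ = (f' - f) * g' + f * (g' - g)); last by ring.
  by apply: ord_geD; [exact: ord_geMl | exact: ord_geMr].
apply: (big_ind2 (fun f' f => ord_ge N (f' - f))) => [|f' f g' g|i _].
- by rewrite subrr; exact: ord_ge0.
- exact: stepM.
elim: (a i) => [|b IH]; first by rewrite !expr0 subrr; exact: ord_ge0.
by rewrite !exprS; apply: stepM.
Qed.

(** Replacing U by U' in a fixed box costs order N. Enlarging the box adds only multi-indices with
    an entry at least N, whose products have order at least N because each [U i] has order at least
    1. *)
Lemma ord_ge_subst_diff N (U U' : 'I_m -> P) :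
  (forall i, ord_ge 1 (U i)) -> (forall i, ord_ge N (U' i - U i)) ->
  ord_ge N (subst_box U' N.+1 - subst_box U N).
Proof.
move=> U1 UU'.
rewrite -(subrKA (subst_box U N.+1)); apply: ord_geD.
  rewrite -sumrB; apply: ord_ge_sum => a _; rewrite -mulrBr.
  exact/ord_geMr/ord_ge_prod_diff.
rewrite boxs_diff //; apply: ord_ge_sum => a; rewrite negb_forall => /existsP[i].
rewrite -leqNgt => Nai; apply: ord_geMr; rewrite (bigD1 i) //=; apply: ord_geMl.
by rewrite ffunE; apply: ord_geW Nai _; exact: ord_geX.
Qed.

(** Majorant principle: submultiplicativity allows each substituted polynomial to be replaced by its
    bound [tau]. *)
Lemma l1_le_subst_box w tau M (U : 'I_m -> P) N :
  (forall k j, 0 <= w k j) -> w 0 0 = 1 ->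
  (forall k j k' j', w (k + k') (j + j') <= w k j * w k' j') ->
  (forall i, l1_le w (U i) tau) ->
  boxs (fun a => `|c a| * \prod_i tau ^+ a i) N <= M ->
  l1_le w (subst_box U N) M.
Proof.
move=> w_ge0 w00 wM Ut cM; apply: l1_leW cM _.
rewrite /subst_box /boxs; apply: l1_le_sum => a _.
apply: l1_leM => //; first exact: l1_leC.
by apply: l1_le_prod => // i _; apply: l1_leX.
Qed.

End Substitution.

(** * Picard iterates: stabilisation and invariant ball *)

(* Picard iteration for u_y = c(u) u_x with u(x, 0) = sum_(k >= 1) v_k x^k;
   the N-th iterate only uses the box partial sum of the power series c. *)
Section PicardIteration.
Variables (m : nat) (c : 'I_m -> 'I_m -> {ffun 'I_m -> nat} -> R).
Variable v : nat -> 'I_m -> R.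

Definition initial_poly (N : nat) (i : 'I_m) : P := \sum_(1 <= k < N) mono (v k i) 0 k.

Fixpoint picard (N : nat) : 'I_m -> P :=
  if N is N'.+1 then fun i =>
    initial_poly N i +
    intY (\sum_l subst_box (c i l) (picard N') N' * dX (picard N' l))
  else fun=> 0.

Lemma picard_dY N i :
  (picard N.+1 i)^`() = \sum_l subst_box (c i l) (picard N) N * dX (picard N l).
Proof.
rewrite /= derivD intYK linear_sum big1 ?add0r // => k _ /=.
by rewrite dY_mono mulr0n mulr0; apply: eq_coef2 => a b; rewrite coef_mono !coef0 mul0r.
Qed.

Lemma coef_initial_poly N i j :
  (initial_poly N i)`_0`_j = if (0 < j < N)%N then v j i else 0.
Proof.
rewrite !coef_sum; under eq_bigr do rewrite coef_mono andbT.
case: ifPn => [jN|jN].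
  rewrite (bigD1_seq j) /= ?iota_uniq ?mem_index_iota // eqxx mulr1 big1 ?addr0 // => k.
  by rewrite eq_sym => /negPf ->; rewrite mulr0.
rewrite big_nat_cond big1 // => k /andP[kN _].
by case: eqP => [jk|]; rewrite ?mulr0 //; lia.
Qed.

(** Integration in y contributes nothing on the row y = 0, so the initial data survive every
    iteration; the prescribed x-derivatives are read off there. *)
Lemma coef_picard N i j : (0 < j < N)%N -> (picard N i)`_0`_j = v j i.
Proof.
case: N => [|N] jN; first by lia.
by rewrite /= !coefD coef_initial_poly coef_intY invr0 mul0r addr0 jN.
Qed.

Lemma ord_ge_picard N i : ord_ge 1 (picard N i).
Proof.
case: N => [|N] /=; first exact: ord_ge0.
apply: ord_geD; last by apply: (@ord_geW _ 2) => //; exact/ord_ge_intY/ord_ge_all0.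
rewrite /initial_poly big_nat_cond; apply: ord_ge_sum => k /andP[k1 _] a b ab.
by rewrite coef_mono; case: andP => [[/eqP bk _]|]; [lia|rewrite mulr0].
Qed.

Lemma ord_ge_picardS N i : ord_ge N (picard N.+1 i - picard N i).
Proof.
elim: N i => [|N IH] i; first exact: ord_ge_all0.
rewrite /= -/(picard N.+1) [_ + _ - _](_ : _ =
    (initial_poly N.+2 i - initial_poly N.+1 i) + intY (\sum_l
     (subst_box (c i l) (picard N.+1) N.+1 * dX (picard N.+1 l) -
      subst_box (c i l) (picard N) N * dX (picard N l)))); last first.
  by rewrite sumrB intYB opprD addrACA.
apply: ord_geD.
  rewrite /initial_poly big_nat_recr //= addrAC subrr add0r => a b ab.
  by rewrite coef_mono; case: andP => [[/eqP bk _]|]; [lia|rewrite mulr0].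
(* Differentiation in x costs one order and integration in y gains two. The truncated predecessor
   lets N = 0 be treated alike. *)
apply: (@ord_geW _ N.-1.+2); first by lia.
apply/ord_ge_intY/ord_ge_sum => l _.
rewrite (_ : _ - _ =
  (subst_box (c i l) (picard N.+1) N.+1 - subst_box (c i l) (picard N) N) *
    dX (picard N.+1 l) +
  subst_box (c i l) (picard N) N * dX (picard N.+1 l - picard N l)).
  apply: ord_geD; last first.
    by apply: ord_geMr; case: N IH => [|N] IH; [exact: ord_ge_all0 | exact: ord_ge_dX].
  apply: ord_geMl; apply: (@ord_geW _ N); first by lia.
  by apply: ord_ge_subst_diff => // j; exact: ord_ge_picard.
by rewrite dXB; ring.
Qed.

Section Bound.
Variables (s lam tau M : R).
Hypotheses (s0 : 0 < s) (lam1 : 1 <= lam) (tau0 : 0 <= tau).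
Hypothesis v_small : forall i N, \sum_(1 <= k < N) `|v k i| * s ^+ k <= tau / 2.
Hypothesis c_bounded :
  forall i l N, boxs (fun a => `|c i l a| * \prod_j tau ^+ a j) N <= M.
Hypothesis lam_large : m%:R * M * 2 <= lam.

Lemma l1_le_picard N i : l1_le (ck_weight s lam) (picard N i) tau.
Proof.
have w_ge0 k j : 0 <= ck_weight s lam k j by rewrite ltW // ck_weight_gt0.
elim: N i => [|N IH] i /=; first exact: l1_leW (l1_le0 _).
have lam0 : 0 < lam by apply: lt_le_trans lam1.
(* Half of tau goes to the initial data, half to the integral: its m terms are at most M tau / lam
   each, and lam >= 2 m M. *)
rewrite (splitr tau) intY_sum; apply: l1_leD.
  apply: l1_leW (v_small i N.+1) _; apply: l1_le_sum => k _.
  by rewrite -(ck_weight0 _ lam); apply: l1_le_mono.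
apply: (@l1_leW _ _ (\sum_(l < m) lam^-1 * M * tau)); last first.
  apply: l1_le_sum => l _; apply: l1_le_intYMdX => //.
  apply: l1_le_subst_box (c_bounded i l N) => //; first exact: ck_weight00.
  exact: ck_weightM.
rewrite sumr_const card_ord -mulr_natl.
rewrite [leLHS](_ : _ = tau * (m%:R * M / lam)); last by ring.
by rewrite ler_wpM2l // ler_pdivrMr // [leRHS]mulrC ler_pdivlMr ?ltr0n mulr1.
Qed.

End Bound.

End PicardIteration.

End BivariatePolynomials.

(** * Norms of column vectors and a criterion for differentiability *)

Section ColumnVectors.
Variable R : realType.

Lemma coord_le_norm m (v : 'cV[R]_m) i : `|v i 0| <= `|v|.
Proof.
rewrite /Num.norm /= mx_normrE.
exact: (le_bigmax _ (fun ij => `|v ij.1 ij.2|) (i, 0)).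
Qed.

Lemma cV_norm_le m (v : 'cV[R]_m) b : 0 <= b -> (forall i, `|v i 0| <= b) -> `|v| <= b.
Proof.
move=> b0 vb; rewrite /Num.norm /= mx_normrE; apply/bigmax_leP; split=> // -[i j] _ /=.
by rewrite ord1.
Qed.

Lemma coord_le_enorm m (v : 'cV[R]_m) i : `|v i 0| <= enorm v.
Proof.
rewrite -sqrtr_sqr ler_wsqrtr // (bigD1 i) //= lerDl.
by apply: sumr_ge0 => j _; apply: sqr_ge0.
Qed.

Lemma norm_le_enorm m (v : 'cV[R]_m) : `|v| <= enorm v.
Proof. by apply: cV_norm_le (coord_le_enorm v); apply: sqrtr_ge0. Qed.

Lemma mulmx_continuous m k (A : 'M[R]_(m, k)) : continuous (mulmx A : 'cV_k -> 'cV_m).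
Proof.
apply: (@bounded_linear_continuous _ 'cV[R]_k 'cV[R]_m (mulmx A)).
apply/linear_boundedP.
near=> M => v.
apply: cV_norm_le => [|i]; first by rewrite mulr_ge0.
rewrite mxE (le_trans (ler_norm_sum _ _ _)) //.
apply: (@le_trans _ _ ((\sum_i \sum_j `|A i j|) * `|v|)).
  rewrite (bigD1 i) //= mulrDl ler_wpDr //.
    by rewrite mulr_ge0 // sumr_ge0 // => ? _; rewrite sumr_ge0.
  by rewrite mulr_suml; apply: ler_sum => j _; rewrite normrM ler_wpM2l // coord_le_norm.
by rewrite ler_wpM2r //; near: M; apply: nbhs_pinfty_ge; rewrite num_real.
Unshelve. all: by end_near. Qed.

Lemma diff_of_quadratic (V W : normedModType R) (f : V -> W) z
    (df : {linear V -> W}) e K :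
  continuous df -> 0 < e ->
  (forall h, `|h| <= e -> `|f (h + z) - f z - df h| <= K * `|h| ^+ 2) ->
  differentiable f z /\ 'd f z = df :> (V -> W).
Proof.
(* The sign of K is unknown; [|K| + 1] is a positive substitute, by which one can divide. *)
move=> dfc e0 fA; have K1 : 0 < `|K| + 1 by rewrite ltr_wpDl.
have fo : f \o shift z = cst (f z) + df +o_ 0 id.
  apply/eqaddoP => _/posnumP[eps].
  near=> h; rewrite /= !fctE /= opprD addrA.
  apply: le_trans (fA h _) _; first by near: h; apply: nbhs0_le.
  rewrite expr2 mulrA ler_wpM2r //.
  apply: (@le_trans _ _ ((`|K| + 1) * `|h|)).
    by rewrite ler_wpM2r // ler_wpDr // ler_norm.
  by rewrite -ler_pdivlMl //.
have dfE := diff_unique dfc fo.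
by split => //; apply/diff_locallyP; rewrite dfE.
Unshelve. all: by end_near. Qed.

End ColumnVectors.

(** * Sums of stabilising sequences of polynomials *)

Section LimitsOfPolynomials.
Variable R : realType.
Local Notation P := {poly {poly R}}.

(* Norm-bounded sequences whose coefficients are eventually constant: the
   partial sums of a convergent power series. *)
Definition stabilising (rho : R) (f : nat -> P) :=
  (exists C, forall N, l1_le (pow_weight rho) (f N) C) /\
  (forall M, exists N0, forall N, (N0 <= N)%N -> ord_ge M (f N - f N0)).

(** [limn] has a junk value without convergence, which [cvg_sum_at] provides on a quarter of the
    radius. *)
Definition sum_at (f : nat -> P) (x y : R) : R := limn (fun N => ev x y (f N)).

Lemma stabilising_dX rho f : 0 < rho -> stabilising rho f ->
  stabilising (rho / 2) (fun N => dX (f N)).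
Proof.
move=> rho0 [[C fC] fM]; split; first by exists (2 / rho * C) => N; apply: l1_le_dX.
move=> M; have [N0 fN0] := fM M.+1; exists N0 => N /fN0 fN.
by rewrite -dXB; apply: ord_ge_dX.
Qed.

Lemma stabilising_dY rho f : 0 < rho -> stabilising rho f ->
  stabilising (rho / 2) (fun N => (f N)^`()).
Proof.
move=> rho0 [[C fC] fM]; split; first by exists (2 / rho * C) => N; apply: l1_le_dY.
move=> M; have [N0 fN0] := fM M.+2; exists N0 => N /fN0 fN.
by rewrite -derivB; apply: ord_ge_dY.
Qed.

Lemma stabilising_shrink rho rho' f : 0 <= rho' <= rho ->
  stabilising rho f -> stabilising rho' f.
Proof.
move=> /andP[rho0 rr] [[C fC] fM]; split=> //; exists C => N.
by apply: l1_le_weight (fC N) => k j; rewrite lerXn2r ?nnegrE // (le_trans rho0).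
Qed.

Lemma stabilising_addC rho f c : 0 <= rho ->
  stabilising rho f -> stabilising rho (fun N => c%:P%:P + f N).
Proof.
move=> rho0 [[C fC] fM]; split.
  exists (`|c| + C) => N; apply: l1_leD => //; apply: l1_leC.
  by rewrite /pow_weight expr0.
move=> M; have [N0 fN0] := fM M; exists N0 => N /fN0.
by rewrite opprD addrACA subrr add0r.
Qed.

(** Cauchy criterion: beyond some [N0] the differences with [f N0] vanish to order M and have norm
    at most 2 C, so on a quarter of the radius their values are at most 2^-M * 2 C. *)
Lemma cvg_sum_at rho f x y : stabilising rho f -> `|x| <= rho / 4 -> `|y| <= rho / 4 ->
  (fun N => ev x y (f N)) @ \oo --> sum_at f x y.
Proof.
move=> [[C fC] fM] xr yr; apply/cauchy_cvgP/cauchy_exP => e e0.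
have rho0 : 0 <= rho by have := normr_ge0 x; lra.
have C0 : 0 <= C by apply: l1_le_ge0 (fC 0%N) => k j; apply: pow_weight_ge0.
have : (fun M : nat => 2^-1 ^+ M * (C + C)) @ \oo --> (0 * (C + C) : R).
  apply: cvgM (cvg_cst _); apply: cvg_expr.
  by rewrite ger0_norm ?invr_ge0 //; lra.
rewrite mul0r => /cvgrPdist_lt /(_ e e0) [M _ /(_ M (leqnn M))] /=.
rewrite sub0r normrN => Me.
have [N0 fN0] := fM M; exists (ev x y (f N0)).
exists N0 => // N.
move=> /fN0 fN.
suff h : `|ev x y (f N0) - ev x y (f N)| < e by rewrite -ball_normE.
rewrite distrC -evB; apply: le_lt_trans Me; apply: le_trans (ler_norm _).
by apply: ev_le xr yr => //; apply: l1_leB.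
Qed.

(** The constant comes from the norm bound, hence does not depend on N, and the inequality passes to
    the limit. The derivatives are controlled at radius 2 r, so they converge for coordinates up to
    r / 2. *)
Lemma sum_at_taylor r f : 0 < r -> stabilising (4 * r) f ->
  exists2 K, 0 <= K & forall x y x' y' h,
    `|x| <= r / 2 -> `|y| <= r / 2 -> `|x'| <= r / 2 -> `|y'| <= r / 2 ->
    `|x' - x| <= h -> `|y' - y| <= h ->
    `|sum_at f x' y' - sum_at f x y - (x' - x) * sum_at (fun N => dX (f N)) x y
       - (y' - y) * sum_at (fun N => (f N)^`()) x y| <= K * h ^+ 2.
Proof.
move=> r0 gf; have [[C fC] _] := gf.
have C0 : 0 <= C.
  by apply: l1_le_ge0 (fC 0%N) => k j; apply: pow_weight_ge0; rewrite mulr_ge0 ?ltW.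
exists (3 / r ^+ 2 * C) => [|x y x' y' h xr yr x'r y'r xh yh].
  by rewrite !mulr_ge0 ?invr_ge0 ?exprn_ge0 ?(ltW r0).
have r40 : 0 < 4 * r by rewrite mulr_gt0.
have gX := stabilising_dX r40 gf; have gY := stabilising_dY r40 gf.
have cf u v : `|u| <= r / 2 -> `|v| <= r / 2 ->
    (fun N => ev u v (f N)) @ \oo --> sum_at f u v.
  by move=> ur vr; apply: cvg_sum_at gf _ _; lra.
have cX : (fun N => ev x y (dX (f N))) @ \oo --> sum_at (fun N => dX (f N)) x y.
  by apply: cvg_sum_at gX _ _; lra.
have cY : (fun N => ev x y (f N)^`()) @ \oo --> sum_at (fun N => (f N)^`()) x y.
  by apply: cvg_sum_at gY _ _; lra.
have cT : (fun N => `|ev x' y' (f N) - ev x y (f N) - (x' - x) * ev x y (dX (f N))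
       - (y' - y) * ev x y (f N)^`()|) @ \oo -->
    `|sum_at f x' y' - sum_at f x y - (x' - x) * sum_at (fun N => dX (f N)) x y
       - (y' - y) * sum_at (fun N => (f N)^`()) x y|.
  apply: cvg_norm; apply: cvgB; last exact: cvgM (cvg_cst _) cY.
  apply: cvgB; last exact: cvgM (cvg_cst _) cX.
  by apply: cvgB; apply: cf.
apply: (cvgr_to_le cT); apply: nearW => N.
rewrite mulrAC; apply: ev_taylor => //; lra.
Qed.

End LimitsOfPolynomials.

(** * Vector-valued sums and their iterated x-derivatives *)

Section VectorSums.
Variable R : realType.
Variable m : nat.
Local Notation P := {poly {poly R}}.
Implicit Types (f : nat -> 'I_m -> P) (z : 'cV[R]_(1 + 1)).

Definition vsum f z : 'cV[R]_m :=
  \col_i sum_at (fun N => f N i) (z 0 0) (z ord_max 0).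

Definition vstabilising rho f := forall i, stabilising rho (fun N => f N i).

Definition vdX f : nat -> 'I_m -> P := fun N i => dX (f N i).
Definition vdY f : nat -> 'I_m -> P := fun N i => (f N i)^`().

Lemma vsum_diff r f z : 0 < r -> vstabilising (4 * r) f -> `|z| < r / 2 ->
  differentiable (vsum f) z /\
  forall v, 'd (vsum f) z v = v 0 0 *: vsum (vdX f) z + v ord_max 0 *: vsum (vdY f) z.
Proof.
move=> r0 gf zr.
have /choice[K HK] : forall i, exists K, 0 <= K /\ forall x y x' y' h,
    `|x| <= r / 2 -> `|y| <= r / 2 -> `|x'| <= r / 2 -> `|y'| <= r / 2 ->
    `|x' - x| <= h -> `|y' - y| <= h ->
    `|sum_at (fun N => f N i) x' y' - sum_at (fun N => f N i) x y -
      (x' - x) * sum_at (fun N => dX (f N i)) x y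
       - (y' - y) * sum_at (fun N => (f N i)^`()) x y| <= K * h ^+ 2.
  by move=> i; have [K K0 HK] := sum_at_taylor r0 (gf i); exists K.
(* The candidate Jacobian: its columns are the sums of the termwise derivatives in x and in y. *)
pose A := \matrix_(i < m, j < 1 + 1)
  (if j == 0 then vsum (vdX f) z i 0 else vsum (vdY f) z i 0).
have AE v : A *m v = v 0 0 *: vsum (vdX f) z + v ord_max 0 *: vsum (vdY f) z.
  apply/matrixP => i j; rewrite ord1 !mxE big_ord_recl big_ord1 !mxE /=.
  rewrite (_ : lift ord0 ord0 = ord_max); last exact/val_inj.
  by rewrite ![_ * sum_at _ _ _]mulrC.
have [e e0 ez] : exists2 e, 0 < e & `|z| + e <= r / 2.
  by exists (r / 2 - `|z|); [rewrite subr_gt0|rewrite addrC subrK].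
have [||dfz dE] := @diff_of_quadratic R _ _ (vsum f) z (mulmx A) e (\sum_i K i) _ e0.
- exact: mulmx_continuous.
- move=> h he; apply: cV_norm_le => [|i].
    by rewrite mulr_ge0 ?exprn_ge0 // sumr_ge0 // => i _; have [] := HK i.
  apply: (@le_trans _ _ (K i * `|h| ^+ 2)); last first.
    rewrite ler_wpM2r ?exprn_ge0 // (bigD1 i) //= lerDl.
    by apply: sumr_ge0 => j _; have [] := HK j.
  rewrite /= AE; have [_] := HK i; move=> /(_ (z 0 0) (z ord_max 0)
    ((h + z) 0 0) ((h + z) ord_max 0) `|h|).
  have zb j : `|z j 0| <= r / 2 by apply: le_trans (coord_le_norm _ _) (ltW zr).
  have hzb j : `|(h + z) j 0| <= r / 2.
    apply: le_trans (coord_le_norm _ _) _; apply: le_trans (ler_normD _ _) _.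
    by apply: le_trans ez; rewrite addrC lerD2l.
  move=> /(_ (zb _) (zb _) (hzb _) (hzb _)).
  rewrite !mxE !addrK => /(_ (coord_le_norm _ _) (coord_le_norm _ _)).
  by rewrite opprD addrA.
by split=> // v; rewrite dE /= AE.
Qed.

Lemma vsum_diff8 e f z : 0 < e -> vstabilising (8 * e) f -> `|z| < e ->
  differentiable (vsum f) z /\
  forall v, 'd (vsum f) z v = v 0 0 *: vsum (vdX f) z + v ord_max 0 *: vsum (vdY f) z.
Proof.
move=> e0 gf ze; apply: (@vsum_diff (2 * e)); first exact: mulr_gt0.
  by rewrite mulrA -natrM.
by rewrite mulrAC divff ?mul1r ?pnatr_eq0.
Qed.

Lemma near_ball_lt (V : normedModType R) e (z : V) :
  `|z| < e -> \forall w \near z, `|w| < e.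
Proof.
move=> ze; near=> w.
have wz : `|w - z| < e - `|z|.
  by near: w; apply: cvgr_distC_lt; rewrite ?subr_gt0.
by rewrite -(subrK z w) (le_lt_trans (ler_normD _ _)) // -ltrBrDr.
Unshelve. all: by end_near. Qed.

Lemma near_eq_continuous_for (V W : normedModType R) (F G : V -> W) (z : V) :
  (\forall w \near z, F w = G w) -> {for z, continuous G} -> {for z, continuous F}.
Proof.
move=> FG cG; rewrite /prop_for /continuous_at (nbhs_singleton FG).
by apply: cvg_trans cG; apply: near_eq_cvg; apply: filterS FG.
Qed.

(** Each differentiation halves the radius, so the disc depends on k; this suffices for derivatives
    at the origin. The identity is asserted on a whole disc in order to be differentiated again. *)
Lemma xderiv_vsum rho f k : 0 < rho -> vstabilising rho f ->
  exists e, [/\ 0 < e, vstabilising (8 * e) (iter k vdX f) &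
    forall z, `|z| < e -> xderiv k (vsum f) z = vsum (iter k vdX f) z].
Proof.
move=> rho0 gf; elim: k => [|k [e [e0 ge IH]]].
  exists (rho / 8); split=> //; first by rewrite divr_gt0.
  by rewrite mulrC divfK // pnatr_eq0.
exists (e / 2); split; first by rewrite divr_gt0.
  move=> i; rewrite mulrA; apply: stabilising_dX (ge i); exact: mulr_gt0.
move=> z ze; have {}ze : `|z| < e.
  by apply: lt_le_trans ze _; rewrite ler_pdivrMr // ler_peMr ?ler1n // ltW.
rewrite /xderiv iterS -/(xderiv k (vsum f)).
rewrite (@near_eq_derive _ _ _ _ (vsum (iter k vdX f))); last first.
  by apply: filterS (near_ball_lt ze) => w; apply: IH.
have [dz dE] := vsum_diff8 e0 ge ze.
by rewrite deriveE // dE !mxE /= scale1r scale0r addr0.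
Qed.

Lemma derivable_xderiv_vsum rho f k : 0 < rho -> vstabilising rho f ->
  \forall w \near (0 : 'cV[R]_(1 + 1)), derivable (xderiv k (vsum f)) w (e_x R).
Proof.
move=> rho0 gf; have [e [e0 ge IH]] := xderiv_vsum k rho0 gf.
have : `|0 : 'cV[R]_(1 + 1)| < e by rewrite normr0.
move=> /near_ball_lt; apply: filterS => w we.
apply: (@near_eq_derivable _ _ _ (vsum (iter k vdX f))).
  by apply: filterS (near_ball_lt we) => u ue; rewrite IH.
by apply: diff_derivable; have [] := vsum_diff8 e0 ge we.
Qed.

End VectorSums.

(** * Truncation of convergent power series *)

Section AnalyticCoefficients.
Variables (R : realType) (m : nat).

(** A box is a finite set of multi-indices, so its sum of absolute values is at most the total one,
    finite by summability. *)
Lemma summable_box_bounded (F : {ffun 'I_m -> nat} -> R) :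
  summable [set: {ffun 'I_m -> nat}] (fun a => (F a)%:E) ->
  exists M, forall N, boxs (fun a => `|F a|) N <= M.
Proof.
rewrite summableE => sF.
exists (fine (\esum_(a in [set: {ffun 'I_m -> nat}]) `|(F a)%:E|%E)) => N.
rewrite -lee_fin fineK //; apply: esum_ge.
pose h (a : {ffun 'I_m -> 'I_N}) := [ffun i => nat_of_ord (a i)].
exists (h @` setT); first by split=> //; apply: finite_image; exact: finite_finset.
rewrite fsbig_image; last first.
  move=> a b _ _ /ffunP ab; apply/ffunP => i; apply/val_inj.
  by have := ab i; rewrite !ffunE.
have -> : [set: {ffun 'I_m -> 'I_N}] = [set` enum {ffun 'I_m -> 'I_N}].
  by apply/seteqP; split=> a //= _; rewrite mem_enum.
by rewrite -fsbig_seq ?enum_uniq // big_enum /= sumEFin.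
Qed.

(** Outside the box of size N some exponent is at least N, so arguments at half the radius tau gain
    2^-N over the majorant. *)
Lemma boxs_tail (c : {ffun 'I_m -> nat} -> R) tau M (u : 'I_m -> R) N K :
  0 <= tau ->
  (forall N, boxs (fun a => `|c a| * \prod_j tau ^+ a j) N <= M) ->
  (forall i, `|u i| <= tau / 2) -> (N <= K)%N ->
  `|boxs (fun a => c a * \prod_i u i ^+ a i) K -
    boxs (fun a => c a * \prod_i u i ^+ a i) N|
    <= 2^-1 ^+ N * M.
Proof.
move=> tau0 cM ut NK; rewrite boxs_diff //; apply: le_trans (ler_norm_sum _ _ _) _.
apply: (@le_trans _ _ (\sum_(a : {ffun 'I_m -> 'I_K} | ~~ [forall i, a i < N]%N)
   2^-1 ^+ N * (`|c [ffun i => nat_of_ord (a i)]| * \prod_j tau ^+ a j))).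
  apply: ler_sum => a; rewrite negb_forall => /existsP[i]; rewrite -leqNgt => Nai.
  rewrite normrM mulrCA ler_wpM2l // normr_prod.
  apply: (@le_trans _ _ (\prod_j ((2^-1 ^+ a j) * tau ^+ a j))).
    apply: ler_prod => j _; rewrite normr_ge0 ffunE normrX -exprMn mulrC.
    by rewrite lerXn2r ?nnegrE ?mulr_ge0 ?invr_ge0.
  rewrite big_split ler_wpM2r //; first by apply: prodr_ge0 => j _; rewrite exprn_ge0.
  rewrite (bigD1 i) //= -[leRHS]mulr1 ler_pM ?exprn_ge0 ?invr_ge0 //.
  - by apply: prodr_ge0 => j _; rewrite exprn_ge0 ?invr_ge0.
  - by apply: ler_wiXn2l; rewrite ?invr_ge0 ?invf_le1 ?ler1n.
  - apply: prodr_ile1 => j _; rewrite exprn_ge0 ?invr_ge0 //= exprn_ile1 ?invr_ge0 //.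
    by rewrite invf_le1 ?ler1n.
rewrite -mulr_sumr ler_wpM2l ?exprn_ge0 ?invr_ge0 //; apply: le_trans (cM K).
rewrite /boxs [leRHS](bigID (fun a : {ffun 'I_m -> 'I_K} => [forall i, a i < N]%N)) /=.
apply: ler_wpDl; last first.
  by apply: ler_sum => a _; rewrite ler_wpM2l // le_eqVlt; apply/orP; left; apply/eqP;
    apply: eq_bigr => j _; rewrite ffunE.
by apply: sumr_ge0 => a _; rewrite mulr_ge0 // prodr_ge0 // => j _; rewrite exprn_ge0.
Qed.

Lemma cvg_boxs (c : {ffun 'I_m -> nat} -> R) (N : nat) (u : nat -> 'I_m -> R)
    (v : 'I_m -> R) :
  (forall i, (fun k => u k i) @ \oo --> v i) ->
  (fun k => boxs (fun a => c a * \prod_i u k i ^+ a i) N) @ \oo -->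
    boxs (fun a => c a * \prod_i v i ^+ a i) N.
Proof.
move=> uv; apply: cvg_big => [|a _]; first exact: add_continuous.
apply: cvgM; first exact: cvg_cst.
apply: cvg_big => [|i _]; first exact: mul_continuous.
by elim: ([ffun _ => _] i) => [|b IH]; [rewrite expr0; exact: cvg_cst|
  under eq_fun do rewrite exprS; rewrite exprS; exact: cvgM].
Qed.

(** Truncation and argument move together. The tail bound is uniform in the argument: one fixes a
    box with small tail and lets the arguments converge in this finite sum, with three errors of e /
    3. *)
Lemma cvg_boxs_diag (c : {ffun 'I_m -> nat} -> R) tau M (u : nat -> 'I_m -> R)
    (v : 'I_m -> R) (l : R) :
  0 <= tau ->
  (forall N, boxs (fun a => `|c a| * \prod_j tau ^+ a j) N <= M) ->
  (forall k i, `|u k i| <= tau / 2) -> (forall i, (fun k => u k i) @ \oo --> v i) ->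
  boxs (fun a => c a * \prod_i v i ^+ a i) @ \oo --> l ->
  (fun k => boxs (fun a => c a * \prod_i u k i ^+ a i) k) @ \oo --> l.
Proof.
move=> tau0 cM ut uv vl.
have vt i : `|v i| <= tau / 2.
  by apply: (cvgr_to_le (cvg_norm (uv i))); apply: nearW => k; exact: ut.
have tail_l N : `|l - boxs (fun a => c a * \prod_i v i ^+ a i) N| <= 2^-1 ^+ N * M.
  have cl : (fun K => `|boxs (fun a => c a * \prod_i v i ^+ a i) K -
      boxs (fun a => c a * \prod_i v i ^+ a i) N|) @ \oo -->
      `|l - boxs (fun a => c a * \prod_i v i ^+ a i) N|.
    by apply: cvg_norm; apply: cvgB vl (cvg_cst _).
  by apply: (cvgr_to_le cl); exists N => // K /= NK; exact: boxs_tail cM vt NK.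
apply/cvgrPdist_le => e e0.
have : (fun N : nat => 2^-1 ^+ N * M) @ \oo --> (0 * M : R).
  apply: cvgM (cvg_cst _); apply: cvg_expr.
  by rewrite ger0_norm ?invr_ge0 //; lra.
have e3 : 0 < e / 3 by rewrite divr_gt0.
rewrite mul0r => /cvgrPdist_le /(_ _ e3) [n _ /(_ n (leqnn n))] /=.
rewrite sub0r normrN => /(le_trans (ler_norm _)) ne.
have /cvgrPdist_le /(_ _ e3) := @cvg_boxs c n _ _ uv.
have : \forall k \near \oo, (n <= k)%N by exists n.
apply: filterS2 => k nk uvk.
have h1 := tail_l n; have h2 := boxs_tail tau0 cM (ut k) nk.
rewrite distrC in h2.
apply: le_trans (_ : e / 3 + e / 3 + e / 3 <= _); last by lra.
move: h1 uvk h2; set A := boxs _ n; set B := boxs _ n; set D := boxs _ k => h1 uvk h2.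
rewrite (_ : l - D = (l - A) + (A - B) + (B - D)); last by ring.
apply: le_trans (ler_normD _ _) _; apply: lerD; last exact: le_trans ne.
apply: le_trans (ler_normD _ _) _; apply: lerD => //; exact: le_trans ne.
Qed.

End AnalyticCoefficients.

(** * Analytic data of J and Taylor coefficients at the origin *)

Section Assembly.
Variable R : realType.
Local Notation P := {poly {poly R}}.

Lemma analytic_mx_data n (U : set 'cV[R]_n) (J : 'cV[R]_n -> 'M[R]_n) p :
  open U -> U p -> real_analytic_mx_on U J ->
  exists (c : 'I_n -> 'I_n -> {ffun 'I_n -> nat} -> R) (tau M : R),
  [/\ 0 < tau, 0 <= M,
    forall i l N, boxs (fun a => `|c i l a| * \prod_j tau ^+ a j) N <= M &
    forall q, `|q - p| <= tau -> U q /\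
      forall i l, box_sum (fun a => c i l a * monom (q - p) a) @ \oo --> J q i l].
Proof.
move=> oU Up anJ.
have /choice[c Hc] : forall il : 'I_n * 'I_n, exists c : {ffun 'I_n -> nat} -> R,
  \forall x \near p,
    summable [set: {ffun 'I_n -> nat}] (fun a => (c a * monom (x - p) a)%:E) /\
    box_sum (fun a => c a * monom (x - p) a) @ \oo --> J x il.1 il.2.
  by move=> [i l]; exact: anJ.
have {}Hc : \forall x \near p, forall il : 'I_n * 'I_n,
    summable [set: {ffun 'I_n -> nat}] (fun a => (c il a * monom (x - p) a)%:E) /\
    box_sum (fun a => c il a * monom (x - p) a) @ \oo --> J x il.1 il.2.
  exact: (@filter_forall _ _ _ _ _ Hc).
have [e /= e0 He] := (nbhs_ballP _ _).1 (filterI (open_nbhs_nbhs (conj oU Up)) Hc).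
have tau0 : 0 < e / 2 by rewrite divr_gt0.
have {}He q : `|q - p| <= e / 2 -> U q /\ forall il : 'I_n * 'I_n,
    summable [set: {ffun 'I_n -> nat}] (fun a => (c il a * monom (q - p) a)%:E) /\
    box_sum (fun a => c il a * monom (q - p) a) @ \oo --> J q il.1 il.2.
  move=> qp; apply: He; rewrite -ball_normE /= distrC (le_lt_trans qp) //.
  by rewrite ltr_pdivrMr // ltr_pMr // ltr1n.
(* At the corner of the cube of radius e / 2 around p all coordinates of x - p equal e / 2, so
   summability there gives the majorant bound with tau = e / 2. *)
have [|_ Hsum] := He (p + const_mx (e / 2)).
  by rewrite addrC addKr; apply: cV_norm_le => [|i]; rewrite ?mxE ?ger0_norm ?(ltW tau0).
have /choice[M HM] : forall il, exists M : R, forall N,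
    boxs (fun a => `|c il a * monom (p + const_mx (e / 2) - p) a|) N <= M.
  by move=> il; apply: summable_box_bounded; have [] := Hsum il.
have {}HM i l N : boxs (fun a => `|c (i, l) a| * \prod_j (e / 2) ^+ a j) N <= M (i, l).
  apply: le_trans (HM (i, l) N); rewrite le_eqVlt; apply/orP; left; apply/eqP.
  apply: eq_bigr => a _; rewrite normrM /monom normr_prod; congr (_ * _).
  by apply: eq_bigr => j _; rewrite addrC addKr mxE normrX ger0_norm ?(ltW tau0).
have M0 i l : 0 <= M (i, l).
  apply: le_trans (HM i l 0%N); apply: sumr_ge0 => a _; rewrite mulr_ge0 //.
  by apply: prodr_ge0 => j _; rewrite exprn_ge0 ?(ltW tau0).
exists (fun i l => c (i, l)), (e / 2), (\sum_(il : 'I_n * 'I_n) M il); split => //.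
- by apply: sumr_ge0 => -[i l] _.
- move=> i l N; apply: le_trans (HM i l N) _.
  by rewrite (bigD1 (i, l)) //= lerDl sumr_ge0 // => -[j k] _.
- by move=> q /He[Uq Hq]; split=> // i l; have [] := Hq (i, l).
Qed.

Lemma geometric_sum_le (q : R) N : 0 <= q <= 2^-1 -> \sum_(1 <= k < N) q ^+ k <= 2 * q.
Proof.
move=> /andP[q0 q2]; case: N => [|N]; first by rewrite big_geq // mulr_ge0.
(* The added term makes the claim inductive: q^(N+1) + 2 q^(N+2) <= 2 q^(N+1), as q <= 1/2. *)
suff : \sum_(1 <= k < N.+1) q ^+ k + 2 * q ^+ N.+1 <= 2 * q.
  by apply: le_trans; rewrite lerDl mulr_ge0 ?exprn_ge0.
elim: N => [|N IH]; first by rewrite big_geq // add0r expr1.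
rewrite big_nat_recr //=; apply: le_trans IH.
have : q ^+ N.+1 * q <= q ^+ N.+1 * 2^-1 by rewrite ler_wpM2l ?exprn_ge0.
by rewrite [q ^+ N.+2]exprSr; lra.
Qed.

Lemma coef_iter_dX k (f : P) a j :
  (iter k (@dX R) f)`_a`_j = f`_a`_(j + k) *+ (j + k) ^_ k.
Proof.
elim: k j => [|k IH] j; first by rewrite addn0 ffactn0.
by rewrite iterS coef_dX IH addSnnS -mulrnA ffactnSr addnS subSn ?leq_addl // addnK.
Qed.

(** Evaluation at the origin reads the constant coefficient, to which k derivations in x bring k!
    times the coefficient of x^k. By hypothesis this is eventually constant. *)
Lemma vsum_taylor_coef m (f : nat -> 'I_m -> P) (v : nat -> 'cV[R]_m) k :
  (\forall N \near \oo, forall i, (f N i)`_0`_k = v k i 0 / k`!%:R) ->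
  vsum (iter k (@vdX R m) f) 0 = v k.
Proof.
move=> fv; apply/matrixP => i j; rewrite ord1 !mxE.
apply: (@lim_near_cst _ _ _ _ _ _ _) => //.
apply: filterS fv => N fN; rewrite ev00.
have -> : iter k (@vdX R m) f N i = iter k (@dX R) (f N i).
  by elim: k {fN} => //= k IH; rewrite /vdX IH.
by rewrite coef_iter_dX add0n fN ffactnn -[LHS]mulr_natr divfK //.
Qed.

Lemma Jstd1E (v : 'cV[R]_(1 + 1)) :
  (Jstd R 1 *m v) 0 0 = - v ord_max 0 /\ (Jstd R 1 *m v) ord_max 0 = v 0 0.
Proof.
have E0 : 0 = lshift 1 (0 : 'I_1) by apply/val_inj.
have E1 : ord_max = rshift 1 (0 : 'I_1) by apply/val_inj.
rewrite -(vsubmxK v) /Jstd mul_block_col !mul0mx add0r addr0 mul1mx mulNmx mul1mx.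
by rewrite E1 E0 !col_mxEu !col_mxEd !mxE.
Qed.

End Assembly.

(** * The limit of the Picard iterates solves the Cauchy problem *)

Section PicardLimit.
Variables (R : realType) (m : nat).
Implicit Types z : 'cV[R]_(1 + 1).
Variables (c : 'I_m -> 'I_m -> {ffun 'I_m -> nat} -> R) (v : nat -> 'I_m -> R).
Variables (s lam tau M : R).
Hypotheses (s0 : 0 < s) (lam1 : 1 <= lam) (tau0 : 0 < tau).
Hypothesis v_small : forall i N, \sum_(1 <= k < N) `|v k i| * s ^+ k <= tau / 2.
Hypothesis c_bounded :
  forall i l N, boxs (fun a => `|c i l a| * \prod_j tau ^+ a j) N <= M.
Hypothesis lam_large : m%:R * M * 2 <= lam.

Let rho := s / (2 * lam).
Let rho0 : 0 < rho.
Proof. by rewrite divr_gt0 ?mulr_gt0 // (lt_le_trans _ lam1). Qed.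

Lemma l1_le_picard_pow N i : l1_le (pow_weight rho) (picard c v N i) tau.
Proof.
apply: l1_le_weight (l1_le_picard s0 lam1 (ltW tau0) v_small c_bounded lam_large N i).
by move=> k j; exact: ck_weight_ge.
Qed.

Lemma stabilising_picard i : stabilising rho (fun N => picard c v N i).
Proof.
split; first by exists tau => N; exact: l1_le_picard_pow.
(* Consecutive iterates of index at least K differ to order at least K, so K itself serves, by
   telescoping. *)
move=> K; exists K => N /subnK <-; elim: (N - K)%N => [|d IH].
  by rewrite add0n subrr; exact: ord_ge0.
rewrite addSn -(subrKA (picard c v (d + K) i)); apply: ord_geD IH.
by apply: (@ord_geW _ _ (d + K)); [exact: leq_addl | exact: ord_ge_picardS].
Qed.

Variable p : 'cV[R]_m.
Let g N i : {poly {poly R}} := (p i 0)%:P%:P + picard c v N i.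
Let u z : 'cV[R]_m := vsum (picard c v) z.

Lemma vstabilising_picard : vstabilising rho g.
Proof. by move=> i; apply: stabilising_addC (ltW rho0) (stabilising_picard i). Qed.

Let coord_le (z : 'cV[R]_(1 + 1)) i : `|z| <= rho / 4 -> `|z i 0| <= rho / 4.
Proof. exact: le_trans (coord_le_norm _ _). Qed.

(** The iterates vanish at the origin, and order 1 in [ev_le] halves the bound tau. This half is the
    room that the tail estimate for the coefficients requires. *)
Lemma ev_picard_le z N i : `|z| <= rho / 4 ->
  `|ev (z 0 0) (z ord_max 0) (picard c v N i)| <= tau / 2.
Proof.
move=> zr; rewrite mulrC -[2^-1]expr1.
by apply: ev_le (@ord_ge_picard _ _ c v N i) (l1_le_picard_pow N i) _ _; exact: coord_le.
Qed.

Lemma cvg_picard z i : `|z| <= rho / 4 ->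
  (fun N => ev (z 0 0) (z ord_max 0) (picard c v N i)) @ \oo --> u z i 0.
Proof.
move=> zr; rewrite mxE; apply: cvg_sum_at (stabilising_picard i) _ _; exact: coord_le.
Qed.

Lemma vsum_picard_shift z : `|z| <= rho / 4 -> vsum g z = p + u z.
Proof.
move=> zr; apply/matrixP => i j; rewrite ord1 !mxE.
apply: cvg_lim => //.
under eq_fun do rewrite rmorphD /= evC.
apply: cvgD; [exact: cvg_cst | have := @cvg_picard z i zr; rewrite mxE; exact].
Qed.

Lemma norm_vsum_picard_le z : `|z| <= rho / 4 -> `|u z| <= tau / 2.
Proof.
move=> zr; apply: cV_norm_le => [|i]; first by rewrite divr_ge0 // ltW.
apply: (cvgr_to_le (cvg_norm (@cvg_picard z i zr))); apply: nearW => N.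
exact: ev_picard_le.
Qed.

Lemma picard_equation (J : 'cV[R]_m -> 'M[R]_m) z :
  `|z| <= rho / 8 ->
  (forall q, `|q - p| <= tau -> forall i l,
     box_sum (fun a => c i l a * monom (q - p) a) @ \oo --> J q i l) ->
  vsum (vdY g) z = J (vsum g z) *m vsum (vdX g) z.
Proof.
move=> zr HJ.
have zr4 : `|z| <= rho / 4 by apply: le_trans zr _; have := rho0; lra.
have gX i := stabilising_dX rho0 (vstabilising_picard i).
have gY i := stabilising_dY rho0 (vstabilising_picard i).
have zr8 i : `|z i 0| <= rho / 2 / 4.
  by apply: le_trans (coord_le_norm _ _) (le_trans zr _); have := rho0; lra.
apply/matrixP => i j; rewrite ord1 !mxE.
have dXg N l : dX (g N l) = dX (picard c v N l).
  apply: eq_coef2 => a b; rewrite !coef_dX coefD coefC.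
  by case: ifP => _; rewrite coefD ?coefC ?coef0 /= add0r.
have dYg N l : (g N l)^`() = (picard c v N l)^`() by rewrite derivD derivC add0r.
have cY := cvg_sum_at (gY i) (zr8 0) (zr8 ord_max).
have cX l := cvg_sum_at (gX l) (zr8 0) (zr8 ord_max).
have cJ l :
  (fun N => ev (z 0 0) (z ord_max 0) (subst_box (c i l) (picard c v N) N)) @ \oo -->
    J (vsum g z) i l.
  under eq_fun do rewrite ev_subst_box.
  apply: (cvg_boxs_diag (ltW tau0) (c_bounded i l) _ (fun i => @cvg_picard z i zr4)).
    by move=> k l'; exact: ev_picard_le.
  rewrite vsum_picard_shift //; have := HJ (p + u z).
  rewrite addrC addKr; apply.
  by apply: le_trans (norm_vsum_picard_le zr4) _; have := tau0; lra.
have cR :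
  (fun N => \sum_l ev (z 0 0) (z ord_max 0) (subst_box (c i l) (picard c v N) N) *
     ev (z 0 0) (z ord_max 0) (dX (g N l))) @ \oo -->
    \sum_l J (vsum g z) i l * vsum (vdX g) z l 0.
  apply: cvg_big => [|l _]; first exact: add_continuous.
  by rewrite mxE; apply: cvgM (cJ l) (cX l).
apply: (cvg_unique _ _ cR) => //.
(* The y-derivative at index N + 1 is the right side at index N, so both have the same limit. *)
have := cY; rewrite -(cvg_shiftS (fun N => ev _ _ _)) /=.
apply: cvg_trans; apply: near_eq_cvg; apply: nearW => N /=.
rewrite dYg picard_dY rmorph_sum; apply: eq_bigr => l _.
by rewrite rmorphM dXg.
Qed.

End PicardLimit.

(** * From the Cauchy problem to J-holomorphic discs *)

Section Disc.
Variables (R : realType) (n : nat).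
Variables (U : set 'cV[R]_(n + n)) (J : 'cV[R]_(n + n) -> 'M[R]_(n + n)).

(** Radius 16 e for g leaves 8 e for its first derivatives, so their sums are themselves
    differentiable where |z| < e; this makes the differential of the sum continuous. *)
Lemma Jholomorphic_vsum (g : nat -> 'I_(n + n) -> {poly {poly R}}) e :
  0 < e -> vstabilising (16 * e) g -> almost_complex_on U J ->
  (forall z, `|z| <= e -> U (vsum g z)) ->
  (forall z, `|z| <= e -> vsum (vdY g) z = J (vsum g z) *m vsum (vdX g) z) ->
  Jholomorphic_disc_germ U J (vsum g).
Proof.
move=> e0 gs acJ gU gJ; exists e => //.
have disc_lt z : disc e z -> `|z| < e by apply: le_lt_trans (norm_le_enorm z).
have gs8 : vstabilising (8 * e) g.
  move=> i; apply: stabilising_shrink (gs i).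
  by rewrite mulr_ge0 ?ler_wpM2r ?ler_nat ?(ltW e0).
have E8 : 16 * e / 2 = 8 * e by lra.
have e16 : 0 < 16 * e by rewrite mulr_gt0.
have gX : vstabilising (8 * e) (vdX g).
  by move=> i; rewrite -E8; exact: stabilising_dX (gs i).
have gY : vstabilising (8 * e) (vdY g).
  by move=> i; rewrite -E8; exact: stabilising_dY (gs i).
split.
- by move=> z /disc_lt/ltW; apply: gU.
- split=> [z /disc_lt ze|w z /disc_lt ze]; first by have [] := vsum_diff8 e0 gs8 ze.
  pose G (z : 'cV[R]_(1 + 1)) :=
    w 0 0 *: vsum (vdX g) z + w ord_max 0 *: vsum (vdY g) z.
  have EG : \forall z' \near z, 'd (vsum g) z' w = G z'.
    by apply: filterS (near_ball_lt ze) => z' z'e; have [_ ->] := vsum_diff8 e0 gs8 z'e.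
  apply: near_eq_continuous_for EG _.
  apply: differentiable_continuous; apply: differentiableD; apply: differentiableZ.
    by have [] := vsum_diff8 e0 gX ze.
  by have [] := vsum_diff8 e0 gY ze.
move=> z /disc_lt ze v; have [_ dg] := vsum_diff8 e0 gs8 ze.
have [j0 j1] := Jstd1E v; rewrite !dg j0 j1 gJ ?ltW //.
(* With g_y = J g_x, applying J to a g_x + b g_y gives a g_y + b J^2 g_x = a g_y - b g_x, the image
   of (-b, a). *)
rewrite mulmxDr -!scalemxAr mulmxA acJ; last by apply: gU; exact: ltW.
by rewrite mulNmx mul1mx scalerN scaleNr addrC.
Qed.

End Disc.

(** * Choice of the constants and conclusion *)

Theorem corollary3p3 (R : realType) (n : nat)
  (U : set 'cV[R]_(n + n)) (J : 'cV[R]_(n + n) -> 'M[R]_(n + n))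
  (openU : open U) (U0 : U 0)
  (acJ : almost_complex_on U J) (anJ : real_analytic_mx_on U J)
  (J0 : J 0 = Jstd R n) :
  exists2 r : R, 0 < r &
    forall x : nat -> 'cV[R]_(n + n),
      enorm (x 0%N) < r ->
      (exists2 rho : R, 0 < rho &
         forall k : nat, (1 <= k)%N -> enorm (x k) <= k`!%:R * rho ^+ k) ->
      exists gamma : 'cV[R]_(1 + 1) -> 'cV[R]_(n + n),
        Jholomorphic_disc_germ U J gamma /\
        forall k : nat, is_xderiv k gamma 0 (x k).
Proof.
have [r /= r0 rU] := (nbhs_ballP _ _).1 (open_nbhs_nbhs (conj openU U0)).
exists r => // x xr [B B0 xB].
have Ux0 : U (x 0%N).
  by apply: rU; rewrite -ball_normE /= sub0r normrN (le_lt_trans (norm_le_enorm _)).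
(* J is expanded at x_0 rather than at 0: tau and M depend on x_0, but r only on U. *)
have [c [tau [M [tau0 M0 cM HJ]]]] := analytic_mx_data openU Ux0 anJ.
pose v k i := x k i 0 / k`!%:R.
(* With q <= 1/2 the geometric sum is at most 2 q, and q <= tau / 4 makes this at most tau / 2. For
   s = q / B the growth hypothesis gives |v_k| s^k <= q^k. *)
pose q := Num.min (2^-1) (tau / 4).
have q0 : 0 < q by rewrite lt_min invr_gt0 ltr0n divr_gt0.
have [q2 qtau] : q <= 2^-1 /\ q <= tau / 4 by rewrite !ge_min !lexx orbT.
pose s := q / B; have s0 : 0 < s by rewrite divr_gt0.
have v_small i N : \sum_(1 <= k < N) `|v k i| * s ^+ k <= tau / 2.
  apply: (@le_trans _ _ (\sum_(1 <= k < N) q ^+ k)); last first.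
    by apply: le_trans (geometric_sum_le N _) _; rewrite ?(ltW q0) //; lra.
  apply: ler_sum_nat => k /andP[k1 _].
  rewrite (_ : q = B * s); last by rewrite mulrC divfK ?gt_eqF.
  rewrite [leRHS]exprMn ler_wpM2r ?exprn_ge0 ?(ltW s0) // normrM normfV normr_nat.
  rewrite ler_pdivrMr ?ltr0n ?fact_gt0 // mulrC.
  exact: le_trans (coord_le_enorm _ _) (xB k k1).
pose lam := 1 + (n + n)%:R * M * 2.
have lam1 : 1 <= lam by rewrite lerDl !mulr_ge0.
have lamM : (n + n)%:R * M * 2 <= lam by rewrite lerDr.
pose rho := s / (2 * lam).
have lam0 : 0 < lam by apply: lt_le_trans lam1.
have rho0 : 0 < rho by apply: divr_gt0 => //; apply: mulr_gt0.
pose g N i : {poly {poly R}} := (x 0%N i 0)%:P%:P + picard c v N i.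
have gs : vstabilising rho g :=
  vstabilising_picard s0 lam1 tau0 v_small cM lamM (x 0%N).
have shift z := @vsum_picard_shift _ _ c v s lam tau M s0 lam1 tau0 v_small cM lamM
  (x 0%N) z.
have eqn z := @picard_equation _ _ c v s lam tau M s0 lam1 tau0 v_small cM lamM
  (x 0%N) J z.
have u_le z := @norm_vsum_picard_le _ _ c v s lam tau M s0 lam1 tau0 v_small cM lamM z.
exists (vsum g); split.
  have zrho (z : 'cV[R]_(1 + 1)) : `|z| <= rho / 16 ->
      `|z| <= rho / 4 /\ `|z| <= rho / 8.
    by move=> zr; split; apply: le_trans zr _; lra.
  (* The radius rho / 16 keeps the reserve of 16 e needed for a C^1 disc. *)
  apply: (@Jholomorphic_vsum _ _ _ _ _ (rho / 16)) => //.
  - by rewrite divr_gt0.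
  - by rewrite mulrC divfK ?pnatr_eq0.
  - move=> z /zrho[z4 _]; have [] // := HJ (vsum g z).
    by rewrite shift // addrC addKr (le_trans (u_le _ z4)) //; lra.
  - move=> z /zrho[_ z8]; apply: eqn z8 _ => w /HJ[_]; exact.
move=> k; split=> [j _|]; first exact: derivable_xderiv_vsum rho0 gs.
have [e [e0 _ ->]] := xderiv_vsum k rho0 gs; last by rewrite normr0.
(* From index k + 1 on, the iterates have their final coefficient of x^k. For k = 0 it is x_0 alone,
   the iterates having order at least 1. *)
apply: vsum_taylor_coef; exists k.+1 => // N /= kN i.
rewrite !coefD !coefC /=; case: k kN => [|k] kN /=.
  by rewrite (@ord_ge_picard _ _ c v N i) // addr0 divr1.
by rewrite add0r coef_picard ?kN.
Qed.
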